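(* The family $\{PSL_2(q) : q \text{ a prime power}\}$ is a family of uniform expanders. That is, there exist $k\in\mathbb{N}$ and a real number $\varepsilon>0$ such that for every prime power $q$ the group $PSL_2(q)$ has a set $S$ of at most $k$ generators for which the Cayley graph $\mathrm{Cay}(PSL_2(q);S)$ is an $\varepsilon$-expander.
   Context: A finite regular graph $X$ is called an $\varepsilon$-expander ($\varepsilon>0$ real) if for every subset $A$ of the vertices of $X$ with $|A|\le\frac12|X|$ one has $|\partial A|\ge\varepsilon|A|$, where $\partial A=\{y\in X : \mathrm{distance}(y,A)=1\}$. For a finite group $G$ with generating set $S$, $\mathrm{Cay}(G;S)$ denotes the (undirected) Cayley graph: the vertices are the elements of $G$, and $g$ is joined to $gs$ for $g\in G$, $s\in S\cup S^{-1}$. Here $PSL_2(q)=PSL_2(\mathbb{F}_q)$. *)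

(* Defs.v *)
From HB Require Import structures.
From mathcomp Require Import all_boot all_order all_algebra all_fingroup all_solvable.
From mathcomp Require Import reals.

Set Implicit Arguments.
Unset Strict Implicit.
Unset Printing Implicit Defensive.

Import Order.TTheory GRing.Theory Num.Theory.

Local Open Scope ring_scope.

(* A finite graph is given by its adjacency relation e on a finType. *)
Section Graph.

Variables (T : finType) (e : rel T).
Implicit Types (A : {set T}) (x y : T) (n : nat).

Definition regular_graph : Prop :=
  exists d : nat, forall x, #|[set y | e x y]| = d.

Definition has_walk n x y : bool :=
  [exists p : n.-tuple T, path e x p && (last x p == y)].

Definition has_walk_from A n y : bool := [exists x in A, has_walk n x y].

(* The distance from A to y is n. No n qualifies when y is not reachable from
   A, i.e., when the distance is infinite. *)
Definition set_distance A y n : bool :=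
  has_walk_from A n y && [forall m : 'I_n, ~~ has_walk_from A m y].

Definition vertex_boundary A : {set T} := [set y | set_distance A y 1].

Definition expander (R : realType) (eps : R) : Prop :=
  [/\ symmetric e, regular_graph, 0 < eps &
      forall A, #|A|%:R <= 2^-1 * #|T|%:R :> R ->
        eps * #|A|%:R <= #|vertex_boundary A|%:R].

End Graph.

Definition cayley (gT : finGroupType) (S : {set gT}) : rel gT :=
  fun g h => [exists s in S :|: S^-1%g, h == (g * s)%g].

Section PSL2.

Variable F : finFieldType.

Definition SL2 : {set {'GL_2[F]}} := [set u : {'GL_2[F]} | \det (GLval u) == 1].

Fact SL2_group_set : group_set SL2.
Proof.
apply/group_setP; split=> [|u v]; rewrite !inE ?GL_1E ?det1 //.
by move=> /eqP du /eqP dv; rewrite GL_ME det_mulmx du dv mulr1.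
Qed.

Canonical SL2_group := Group SL2_group_set.

Definition PSL2 : finGroupType := [subg (SL2 / 'Z(SL2))%G].

End PSL2.

Definition prime_power (q : nat) : Prop :=
  exists p m : nat, [/\ prime p, (0 < m)%N & q = (p ^ m)%N].

(* Main.v *)
(* One argument treats all large q. Take ten elements s of PSL2(q), the
   transvections along five lines with parameter +-t. Over F[X] they move any
   vector to one of larger degree, up to one exceptional line, so by counting
   roots some specialization X := t makes a random word of length n ~ log q
   trivial with probability at most q^-c. Let M be the averaging operator of s
   on the mean-zero functions on the group and P its spectral projection for the
   eigenvalues >= theta. Then P <= theta^-n M^n. Conjugating M^n by a uniform x
   averages it to a central operator, and since |chi(g)| / chi(1) is
   O(q^(-1/2)) for g <> 1 and chi <> 1, the average of x P x^-1 is at most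
   q^-c' once theta is close to 1. Hence, choosing x_1, ..., x_j one after the
   other, the product of the projections x_i P x_i^-1 can be given
   Hilbert-Schmidt norm at most |G|^(1/2) q^(-c'j/2), which is less than 1/2 for
   some j independent of q. A function almost invariant under all the x_i s x_i^-1
   is almost fixed by each projection, hence by their product: a contradiction. *)

Require Import Defs.
From mathcomp Require Import all_boot all_order all_algebra all_fingroup all_solvable.
From mathcomp Require Import all_field all_character.
From mathcomp Require Import spectral sesquilinear ring lra zify.
From mathcomp Require Import reals.

Set Implicit Arguments.
Unset Strict Implicit.
Unset Printing Implicit Defensive.

Import Order.TTheory GRing.Theory Num.Theory.

Local Open Scope ring_scope.

(** * Quadratic forms and products of projections *)

Section QuadraticForm.
Local Open Scope sesquilinear_scope.
Variables (C : numClosedFieldType) (n : nat).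
Implicit Types (A B M P : 'M[C]_n) (v w : 'rV[C]_n).

(** Vectors are rows and operators act on the right, so [qform 1%:M v] is the squared norm of
    [v]. *)
Definition qform A v : C := (v *m A *m v^t*) 0 0.

Lemma qformD A B v : qform (A + B) v = qform A v + qform B v.
Proof. by rewrite /qform mulmxDr mulmxDl mxE. Qed.

Lemma qformN A v : qform (- A) v = - qform A v.
Proof. by rewrite /qform mulmxN mulNmx mxE. Qed.

Lemma qformB A B v : qform (A - B) v = qform A v - qform B v.
Proof. by rewrite qformD qformN. Qed.

Lemma qformZ a A v : qform (a *: A) v = a * qform A v.
Proof. by rewrite /qform -scalemxAr -scalemxAl mxE. Qed.

Lemma qform_sum (I : Type) (r : seq I) (Q : pred I) (F : I -> 'M[C]_n) v :
  qform (\sum_(i <- r | Q i) F i) v = \sum_(i <- r | Q i) qform (F i) v.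
Proof. by rewrite /qform mulmx_sumr mulmx_suml summxE. Qed.

Lemma adjmxM m p q (A : 'M[C]_(m, p)) (B : 'M[C]_(p, q)) :
  (A *m B)^t* = B^t* *m A^t*.
Proof. by rewrite trmx_mul map_mxM. Qed.

Lemma adjmxB m p (A B : 'M[C]_(m, p)) : (A - B)^t* = A^t* - B^t*.
Proof. by rewrite linearB map_mxB. Qed.

Lemma adjmx1 p : (1%:M)^t* = 1%:M :> 'M[C]_p.
Proof. by rewrite trmx1 map_mx1. Qed.

Lemma qform_conj A B v : qform (B *m A *m B^t*) v = qform A (v *m B).
Proof. by rewrite /qform adjmxM !mulmxA. Qed.

Lemma qform_gram B v : qform (B *m B^t*) v = qform 1%:M (v *m B).
Proof. by rewrite -qform_conj mulmx1. Qed.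

Lemma qform1E v : qform 1%:M v = \sum_i `|v 0 i| ^+ 2.
Proof. by rewrite /qform mulmx1 mxE; apply: eq_bigr => i _; rewrite !mxE normCK. Qed.

Lemma qform1_ge0 v : 0 <= qform 1%:M v.
Proof. by rewrite qform1E; apply: sumr_ge0 => i _; rewrite exprn_ge0. Qed.

Lemma qform_diag (d : 'rV[C]_n) v :
  qform (diag_mx d) v = \sum_i d 0 i * `|v 0 i| ^+ 2.
Proof.
rewrite /qform mul_mx_diag mxE; apply: eq_bigr => i _.
by rewrite !mxE normCK mulrA [_ * d _ _]mulrC.
Qed.

(** In an eigenbasis of [M] both inequalities become scalar ones at each eigenvalue x <= 1, with [P]
    the indicator of theta <= x. Eigenvalues may be negative, of any size; the even exponent keeps
    x^k nonnegative there. *)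
Lemma spectral_cut M (theta : C) k :
    M^t* = M -> (forall v, qform M v <= qform 1%:M v) ->
    0 < theta < 1 -> ~~ odd k ->
  exists P, [/\ P^t* = P, P *m P = P,
    forall v, (1 - theta) * (qform 1%:M v - qform P v)
              <= qform 1%:M v - qform M v &
    forall v, theta ^+ k * qform P v <= qform (M ^+ k) v].
Proof.
move=> hM cM /andP[t0 t1] ek.
have herM : M \is hermsymmx.
  by apply/is_hermitianmxP; rewrite expr0 scale1r hM.
pose U := spectralmx M; pose d := spectral_diag M.
have Uu : U \is unitarymx by apply: spectral_unitarymx.
have UU : U *m U^t* = 1%:M by apply/unitarymxP.
have UU' : U^t* *m U = 1%:M by apply: mulmx1C.
have MU : M = U^t* *m diag_mx d *m U.
  have /orthomx_spectralP := hermitian_normalmx herM.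
  by rewrite invmx_unitary.
(* Functional calculus: [fc f] is f(M), and [fcM] says that it is multiplicative. *)
pose fc (f : C -> C) := U^t* *m diag_mx (\row_i f (d 0 i)) *m U.
have fcM f g : fc f *m fc g = fc (fun x => f x * g x).
  rewrite /fc !mulmxA -[_ *m U *m U^t*]mulmxA UU mulmx1 -[_ *m diag_mx _ *m diag_mx _]mulmxA.
  by rewrite mulmx_diag; congr (_ *m diag_mx _ *m _); apply/rowP=> i; rewrite !mxE.
have qfc f v : qform (fc f) v = \sum_i f (d 0 i) * `|(v *m U^t*) 0 i| ^+ 2.
  rewrite /fc -{2}[U]trmxCK qform_conj qform_diag.
  by apply: eq_bigr => i _; rewrite mxE.
have q1 v : qform 1%:M v = \sum_i `|(v *m U^t*) 0 i| ^+ 2.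
  by rewrite -qform1E -qform_gram trmxCK UU'.
have Mfc : M = fc id.
  by rewrite {1}MU /fc; congr (_ *m diag_mx _ *m _); apply/rowP=> i; rewrite !mxE.
have fcX j : M ^+ j = fc (fun x => x ^+ j).
  elim: j => [|j IH].
    rewrite expr0 /fc (_ : diag_mx _ = 1%:M) ?mulmx1 ?UU' //.
    by rewrite -diag_const_mx; congr diag_mx; apply/rowP => i; rewrite !mxE.
  rewrite exprS IH {1}Mfc [LHS]fcM.
  by rewrite /fc; congr (_ *m diag_mx _ *m _); apply/rowP=> i; rewrite !mxE exprS.
have dR i : d 0 i \is Num.real.
  by have /mxOverP := hermitian_spectral_diag_real herM; apply.
(* Row i of [U] is a unit eigenvector for [d 0 i]; the bound on [M] is tested on it. *)
have d1 i : d 0 i <= 1.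
  have := cM (delta_mx 0 i *m U); rewrite -[M]expr1 fcX qfc q1.
  rewrite -mulmxA UU mulmx1 (bigD1 i) //= [X in _ <= X](bigD1 i) //= !big1.
  - by rewrite !mxE !eqxx normr1 expr1n !addr0 mulr1 expr1.
  - by move=> j /negPf ji; rewrite !mxE ji andbF normr0 expr0n.
  - by move=> j /negPf ji; rewrite !mxE ji andbF normr0 expr0n mulr0.
pose P := fc (fun x => (theta <= x)%R%:R).
exists P; split.
- rewrite /P /fc !adjmxM trmxCK mulmxA. congr (_ *m _ *m _).
  by rewrite tr_diag_mx map_diag_mx; congr diag_mx; apply/rowP => i; rewrite !mxE rmorph_nat.
- rewrite fcM /P /fc; congr (_ *m diag_mx _ *m _); apply/rowP=> i.
  by rewrite !mxE -natrM mulnb andbb.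
- move=> v; rewrite -[M]expr1 fcX !qfc q1 -!sumrB mulr_sumr.
  apply: ler_sum => i _; set w := `|_| ^+ 2; have w0 : 0 <= w by rewrite exprn_ge0.
  rewrite -{1 3}[w]mul1r -!mulrBl mulrA; apply: ler_wpM2r => //.
  rewrite expr1; case: (real_leP (gtr0_real t0) (dR i)) => h /=.
    by rewrite subrr mulr0 subr_ge0.
  by rewrite subr0 mulr1 lerD2l lerN2 ltW.
- move=> v; rewrite fcX !qfc mulr_sumr; apply: ler_sum => i _; rewrite mulrA.
  apply: ler_wpM2r; first by rewrite exprn_ge0.
  case: (real_leP (gtr0_real t0) (dR i)) => h /=.
    by rewrite mulr1 lerXn2r // ?nnegrE ?(ltW t0) // (le_trans (ltW t0)).
  by rewrite mulr0 real_exprn_even_ge0.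
Qed.


Lemma qform1_parallelogram u v :
  qform 1%:M (u + v) + qform 1%:M (u - v) = 2 * (qform 1%:M u + qform 1%:M v).
Proof.
rewrite !qform1E -!big_split /= mulr_sumr; apply: eq_bigr => i _.
rewrite !mxE !normCK !rmorphD rmorphN /=; ring.
Qed.

Lemma qform1_le_add u v :
  qform 1%:M (u + v) <= 2 * (qform 1%:M u + qform 1%:M v).
Proof. by rewrite -qform1_parallelogram lerDl qform1_ge0. Qed.

Lemma mxtrace_gram (B : 'M[C]_n) : \tr (B *m B^t*) = \sum_i \sum_j `|B i j| ^+ 2.
Proof.
by apply: eq_bigr => i _; rewrite mxE; apply: eq_bigr => j _; rewrite !mxE normCK.
Qed.

(** Cauchy-Schwarz on each column of [B]: the Hilbert-Schmidt norm dominates the operator norm. *)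
Lemma qform1_mulmx (B : 'M[C]_n) v :
  qform 1%:M (v *m B) <= \tr (B *m B^t*) * qform 1%:M v.
Proof.
rewrite mxtrace_gram exchange_big /= mulr_suml qform1E; apply: ler_sum => j _.
pose w := (col j B)^t*.
have wE k : w 0 k = (B k j)^* by rewrite !mxE.
have : `|dotmx v w| ^+ 2 <= dotmx v v * dotmx w w.
  by have [] := CauchySchwarz (@dotmx C n) v w.
have dE u : dotmx u u = qform 1%:M u by rewrite dotmxE /qform mulmx1.
rewrite !dE !qform1E mulrC dotmxE; congr (`|_| ^+ 2 <= _ * _).
  by rewrite !mxE; apply: eq_bigr => k _; rewrite !mxE conjCK.
by apply: eq_bigr => k _; rewrite wE norm_conjC.
Qed.

Lemma mxtrace_le_qform A (B : 'M[C]_n) c :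
    (forall v, qform A v <= c * qform 1%:M v) ->
  \tr (B *m A *m B^t*) <= c * \tr (B *m B^t*).
Proof.
move=> hA; rewrite mulr_sumr; apply: ler_sum => i _.
have rowq D : (B *m D *m B^t*) i i = qform D (row i B).
  rewrite /qform !mxE; apply: eq_bigr => j _; rewrite !mxE; congr (_ * _).
  by apply: eq_bigr => k _; rewrite !mxE.
by have := rowq 1%:M; rewrite mulmx1 rowq => ->.
Qed.

(** * Products of orthogonal projections *)

Section Projections.
Variables (X : finType) (Q : X -> 'M[C]_n).
Hypothesis Qadj : forall x, (Q x)^t* = Q x.
Hypothesis Qidem : forall x, Q x *m Q x = Q x.

Lemma qform_proj x v : qform (Q x) v = qform 1%:M (v *m Q x).
Proof. by rewrite -qform_gram Qadj Qidem. Qed.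

Lemma qform_proj_le x v : qform 1%:M (v *m Q x) <= qform 1%:M v.
Proof.
rewrite -qform_proj -subr_ge0 -qformB (_ : 1%:M - Q x = (1%:M - Q x) *m (1%:M - Q x)^t*).
  by rewrite qform_gram qform1_ge0.
rewrite adjmxB adjmx1 Qadj mulmxBl !mulmxBr !mul1mx mulmx1 Qidem.
by rewrite subrr subr0.
Qed.

Lemma qform_sub_proj x v : qform 1%:M (v - v *m Q x) = qform 1%:M v - qform (Q x) v.
Proof.
rewrite -qformB (_ : 1%:M - Q x = (1%:M - Q x) *m (1%:M - Q x)^t*).
  by rewrite qform_gram mulmxBr mulmx1.
rewrite adjmxB adjmx1 Qadj mulmxBl !mulmxBr !mul1mx mulmx1 Qidem.
by rewrite subrr subr0.
Qed.

Lemma proj_product_small_trace (c : C) (j : nat) :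
    0 <= c -> (0 < #|X|)%N ->
    (forall v, qform (\sum_x Q x) v <= #|X|%:R * c * qform 1%:M v) ->
  exists2 xs : seq X, size xs = j &
    let B := \prod_(x <- xs) Q x in \tr (B *m B^t*) <= c ^+ j * n%:R.
Proof.
move=> c0 X0 hQ; elim: j => [|j [xs sxs]] /=.
  exists [::] => //; rewrite big_nil expr0 mul1r.
  by rewrite [X in _ *m X](_ : _ = 1%:M) ?adjmx1 // mulmx1 mxtrace1.
set B := \prod_(x <- xs) _ => hB.
have trE x : \tr (B *m Q x *m (B *m Q x)^t*) = \tr (B *m Q x *m B^t*).
  by rewrite adjmxM Qadj mulmxA -[B *m _ *m _]mulmxA Qidem.
have tr_ge0 x : 0 <= \tr (B *m Q x *m B^t*).
  by rewrite -trE mxtrace_gram; do 2!apply: sumr_ge0 => ? _; rewrite exprn_ge0.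
have [x hx] : exists x, \tr (B *m Q x *m B^t*) <= c * \tr (B *m B^t*).
  have trB0 : 0 <= \tr (B *m B^t*).
    by rewrite mxtrace_gram; do 2!apply: sumr_ge0 => ? _; rewrite exprn_ge0.
  apply/existsP; apply: contraT; rewrite negb_exists => /forallP hlt.
  have := mxtrace_le_qform B hQ; rewrite mulmx_sumr mulmx_suml raddf_sum /=.
  rewrite -mulrA mulr_natl -sumr_const.
  have lt x : c * \tr (B *m B^t*) < \tr (B *m Q x *m B^t*).
    by rewrite real_ltNge ?hlt // ger0_real // mulr_ge0.
  have /card_gt0P[x0 _] := X0.
  suff /lt_geF -> : \sum_(i in X) c * \tr (B *m B^t*)
                    < \sum_i \tr (B *m Q i *m B^t*) by [].
  by apply: ltr_sum => [|x _]; [apply/hasP; exists x0; rewrite ?mem_index_enum | apply: lt].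
exists (rcons xs x); first by rewrite size_rcons sxs.
rewrite big_rcons /= -/B trE (le_trans hx) //.
by rewrite exprS -mulrA ler_wpM2l.
Qed.

(** Prepending a projection adds its own drift, moved by the contraction [B]; squared norms of sums
    cost a factor 2. The constants obey c' = 2 (c + 1) from c = 0, hence 2^(j+1) - 2. *)
Lemma proj_product_drift (xs : seq X) v e :
    (forall x, x \in xs -> qform 1%:M (v - v *m Q x) <= e) ->
  qform 1%:M (v - v *m \prod_(x <- xs) Q x) <= (2 ^+ (size xs).+1 - 2) * e.
Proof.
elim: xs => [|x xs IH] hxs.
  rewrite big_nil mulmx1 subrr subrr mul0r qform1E big1 // => i _.
  by rewrite mxE normr0 expr0n.
rewrite big_cons; set B := \prod_(_ <- _) _ in IH *.
have e1 : qform 1%:M (v - v *m Q x) <= e by apply: hxs; rewrite mem_head.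
have e2 : qform 1%:M (v - v *m B) <= (2 ^+ (size xs).+1 - 2) * e.
  by apply: IH => y yxs; apply: hxs; rewrite in_cons yxs orbT.
have contr u : qform 1%:M (u *m B) <= qform 1%:M u.
  rewrite /B; elim: (xs) u => [|y ys IHys] u; first by rewrite big_nil mulmx1.
  by rewrite big_cons mulmxA (le_trans (IHys _)) // qform_proj_le.
have -> : v - v *m (Q x *m B) = (v - v *m B) + (v - v *m Q x) *m B.
  by rewrite mulmxBl mulmxA addrA subrK.
apply: (le_trans (qform1_le_add _ _)).
have -> : (2 ^+ (size (x :: xs)).+1 - 2) * e
          = 2 * ((2 ^+ (size xs).+1 - 2) * e + e) by rewrite /= [in LHS]exprS; ring.
by rewrite ler_wpM2l // lerD // (le_trans (contr _)).
Qed.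

(** Here [B] at least halves the norm of [v], yet it moves [v] only by the drift. So |v|^2 <= 2
    (drift + |v|^2 / 4), and half of |v|^2 is absorbed on the left. *)
Lemma proj_product_gap (xs : seq X) v e :
    let B := \prod_(x <- xs) Q x in
    \tr (B *m B^t*) <= 4^-1 ->
    0 <= e ->
    (forall x, x \in xs -> qform 1%:M (v - v *m Q x) <= e) ->
  qform 1%:M v <= 2 ^+ (size xs).+3 * e.
Proof.
move=> B trB e0 hxs.
have h1 := proj_product_drift hxs; rewrite -/B in h1.
have h2 : qform 1%:M (v *m B) <= 4^-1 * qform 1%:M v.
  by apply: le_trans (qform1_mulmx _ _) _; rewrite ler_wpM2r ?qform1_ge0.
have := qform1_le_add (v - v *m B) (v *m B); rewrite subrK => h3.
have h4 : qform 1%:M v <= 2 * ((2 ^+ (size xs).+1 - 2) * e + 4^-1 * qform 1%:M v).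
  by apply: le_trans h3 _; rewrite ler_wpM2l // lerD.
have h5 : 2^-1 * qform 1%:M v <= 2 * ((2 ^+ (size xs).+1 - 2) * e).
  rewrite -(lerD2r (2^-1 * qform 1%:M v)) -mulrDl.
  rewrite (_ : 2^-1 + 2^-1 = 1 :> C) ?mul1r; last by field.
  by apply: le_trans h4 _; rewrite mulrDr lerD2l mulrA (_ : 2 * 4^-1 = 2^-1 :> C) //; field.
have := ler_wpM2l (ler0n C 2) h5; rewrite mulVKf ?pnatr_eq0 //.
move/le_trans; apply.
rewrite (_ : 2 * _ = 2 ^+ (size xs).+3 * e - 8 * e); last by rewrite !exprS; ring.
by rewrite gerBl mulr_ge0.
Qed.

End Projections.

End QuadraticForm.

(** * The regular representation *)

Section RegularRepresentation.
Local Open Scope sesquilinear_scope.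
Variable gT : finGroupType.
Local Notation N := #|gT|.
Local Notation G := [set: gT]%G.
Implicit Types (g h x y : gT) (v : 'rV[algC]_N).

(** The right regular representation: on row vectors it carries the mass at x to x g. *)
Definition regmx g : 'M[algC]_N :=
  \matrix_(i, j) (enum_val j == enum_val i * g)%g%:R.

Definition onesmx : 'M[algC]_N := const_mx 1.

Lemma big_enum_valT (F : gT -> algC) : \sum_(i < N) F (enum_val i) = \sum_x F x.
Proof. by rewrite [RHS](reindex (@enum_val gT predT)) //; apply/onW_bij/enum_val_bij. Qed.

Lemma regmxM g h : regmx (g * h) = regmx g *m regmx h.
Proof.
apply/matrixP => i j; rewrite !mxE.
under eq_bigr => k _ do rewrite !mxE -natrM mulnb.
rewrite (big_enum_valT (fun y => ((y == enum_val i * g) && (enum_val j == y * h))%g%:R)).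
rewrite (bigD1 (enum_val i * g)%g) //= eqxx mulgA big1 ?addr0 // => y /negPf -> //.
Qed.

Lemma regmx1 : regmx 1 = 1%:M.
Proof.
by apply/matrixP => i j; rewrite !mxE mulg1 (inj_eq enum_val_inj) eq_sym.
Qed.

Lemma adj_regmx g : (regmx g)^t* = regmx g^-1.
Proof.
apply/matrixP => i j; rewrite !mxE rmorph_nat; congr (nat_of_bool _)%:R.
by rewrite -(inj_eq (mulIg g^-1%g)) mulgK eq_sym.
Qed.

Lemma regmx_onesmx g : regmx g *m onesmx = onesmx.
Proof.
apply/matrixP => i j; rewrite !mxE.
under eq_bigr => k _ do rewrite !mxE mulr1.
rewrite (big_enum_valT (fun y => (y == enum_val i * g)%g%:R)).
by rewrite (bigD1 (enum_val i * g)%g) //= eqxx big1 ?addr0 // => y /negPf ->.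
Qed.

Lemma onesmx_regmx g : onesmx *m regmx g = onesmx.
Proof.
rewrite -[LHS]trmxCK adjmxM adj_regmx.
have -> : onesmx^t* = onesmx by apply/matrixP => i j; rewrite !mxE rmorph1.
by rewrite regmx_onesmx; apply/matrixP => i j; rewrite !mxE rmorph1.
Qed.

Lemma qform_regmx g v : qform 1%:M (v *m regmx g) = qform 1%:M v.
Proof. by rewrite -qform_gram adj_regmx -regmxM mulgV regmx1. Qed.

(** The regular action of the central idempotent belonging to the complex conjugate of ['chi_i];
    this is why [sum_regmx_conj] involves the conjugate value. *)
Definition isotypic_proj (i : Iirr G) : 'M[algC]_N :=
  \matrix_(a, b) ('chi_i 1%g / N%:R * 'chi_i ((enum_val a)^-1 * enum_val b)%g).

Lemma N_neq0 : N%:R != 0 :> algC.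
Proof. by rewrite pnatr_eq0 -lt0n; apply/card_gt0P; exists 1%g. Qed.

Lemma adj_isotypic_proj i : (isotypic_proj i)^t* = isotypic_proj i.
Proof.
apply/matrixP => a b; rewrite !mxE !rmorphM fmorphV rmorph_nat /=.
rewrite -!irr_inv ?inE // invg1 invMg invgK //.
Qed.

Lemma isotypic_proj_idem i : isotypic_proj i *m isotypic_proj i = isotypic_proj i.
Proof.
apply/matrixP => a b; rewrite !mxE.
set y := (_^-1 * enum_val b)%g.
have := generalized_orthogonality_relation y i i; rewrite eqxx mul1r cardsT.
move/(canRL (mulVKf N_neq0)) => h.
transitivity (\sum_z 'chi_i 1%g / N%:R * 'chi_i ((enum_val a)^-1 * z)%g
    * ('chi_i 1%g / N%:R * 'chi_i (z^-1 * (enum_val a * y))%g)).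
  by rewrite -big_enum_valT; apply: eq_bigr => c _; rewrite !mxE mulKVg.
rewrite (reindex (fun z => enum_val a * z^-1)%g) /=; last first.
  exists (fun z => z^-1 * enum_val a)%g => z _; first by rewrite invMg invgK mulgKV.
  by rewrite invMg invgK mulKVg.
transitivity (('chi_i 1%g / N%:R) ^+ 2 * \sum_(x in G) 'chi_i (x * y)%g * 'chi_i x^-1%g).
  rewrite mulr_sumr; apply: eq_big => [z|z _]; first by rewrite inE.
  rewrite mulKg invMg invgK mulgA mulgKV; ring.
by rewrite h; field; rewrite N_neq0 irr1_neq0.
Qed.

(** Entrywise this is second orthogonality: the entry at (a, b) counts the x with x g x^-1 = h,
    where h = a^-1 b. There are |C(h)| of them if h is conjugate to g, and none otherwise. *)
Lemma sum_regmx_conj g :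
  \sum_x regmx (x * g * x^-1)
  = \sum_i (N%:R * ('chi_i g)^* / 'chi_i 1%g) *: isotypic_proj i.
Proof.
apply/matrixP => a b; rewrite !summxE.
set h := ((enum_val a)^-1 * enum_val b)%g.
transitivity (\sum_(x : gT) (h == g ^ (x^-1))%g%:R : algC).
  apply: eq_bigr => x _; rewrite mxE /conjg invgK [(x * (g * _))%g]mulgA.
  by rewrite -[in RHS](inj_eq (mulgI (enum_val a))) mulKVg.
transitivity (#|'C_G[h]%g|%:R *+ (h \in g ^: G)%g : algC); last first.
  rewrite -second_orthogonality_relation ?inE //; apply: eq_bigr => i _.
  by rewrite !mxE; field; rewrite N_neq0 irr1_neq0.
case: imsetP => [[y _ hE]|hC]; last first.
  rewrite big1 // => x _; case: eqP => // hx; case: hC.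
  by exists x^-1%g; rewrite ?inE.
rewrite mulr1n (reindex (fun z => (y * z)^-1)%g) /=; last first.
  exists (fun x => y^-1 * x^-1)%g => z _; first by rewrite invgK mulKg.
  by rewrite mulKVg invgK.
rewrite -sum1_card natr_sum [RHS]big_mkcond; apply: eq_bigr => z _.
rewrite invgK conjgM -hE in_setI in_setT /=.
have -> : (z \in 'C[h])%g = (h == h ^ z)%g.
  by rewrite eq_sym conjg_fix; apply/cent1P/commgP => /commute_sym.
by case: eqP.
Qed.

Lemma sum_isotypic_proj : \sum_i isotypic_proj i = 1%:M.
Proof.
have := sum_regmx_conj 1.
under eq_bigr => x _ do rewrite mulg1 mulgV regmx1.
rewrite sumr_const.
under [RHS]eq_bigr => i _.
  rewrite -irr_inv ?inE // invg1 mulfK ?irr1_neq0 //. over.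
rewrite -scaler_sumr -scaler_nat => /(scalerI N_neq0) <- //.
Qed.

Lemma isotypic_proj0 : N%:R *: isotypic_proj 0 = onesmx.
Proof.
by apply/matrixP => a b; rewrite !mxE irr0 !cfun1E !inE /= mulr1 mul1r divff ?N_neq0.
Qed.

(* On the [i]-th isotypic part the class sum of [g] is the scalar
   N chi_i(g)^* / chi_i(1), and the trivial part is [onesmx]. *)
Lemma class_average_gap g kappa v :
    0 <= kappa ->
    (forall i : Iirr G, i != 0 -> `|'chi_i g| <= kappa * 'chi_i 1%g) ->
  `|qform (\sum_x regmx (x * g * x^-1) - onesmx) v| <= N%:R * kappa * qform 1%:M v.
Proof.
move=> k0 hg.
have E0 i : 0 <= qform (isotypic_proj i) v.
  by rewrite -isotypic_proj_idem -{2}adj_isotypic_proj qform_gram qform1_ge0.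
rewrite sum_regmx_conj (bigD1 0) //= irr0 !cfun1E !inE rmorph1 divr1 mulr1.
rewrite isotypic_proj0 addrAC subrr add0r qform_sum.
rewrite -sum_isotypic_proj qform_sum mulr_sumr [X in _ <= X](bigD1 0) //=.
apply: le_trans (ler_norm_sum _ _ _) _.
rewrite -[X in X <= _]add0r lerD //; first by rewrite !mulr_ge0.
apply: ler_sum => i i0; rewrite qformZ !normrM (ger0_norm (E0 i)).
apply: ler_wpM2r => //; rewrite normrV ?unitfE ?irr1_neq0 // norm_conjC normr_nat.
rewrite -mulrA ler_wpM2l ?ler0n // (ger0_norm (ltW (irr1_gt0 i))).
by rewrite ler_pdivrMr ?irr1_gt0 ?hg.
Qed.

End RegularRepresentation.

(** * Random conjugates of a walk *)

(** All words of length n, arranged so that sums over them peel off the first letter. *)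
Fixpoint words (I : finType) (n : nat) : seq (seq I) :=
  if n is m.+1 then [seq i :: w | i <- enum I, w <- words I m] else [:: [::]].

Lemma big_words (R : nmodType) (I : finType) n (F : seq I -> R) :
  \sum_(w <- words I n.+1) F w = \sum_i \sum_(w <- words I n) F (i :: w).
Proof. by rewrite big_allpairs_dep big_enum. Qed.

Lemma size_words (I : finType) n : size (words I n) = (#|I| ^ n)%N.
Proof. by elim: n => //= n IH; rewrite size_allpairs IH -cardE expnS. Qed.

Lemma sum_words_const (R : nmodType) (I : finType) n (x : R) :
  \sum_(w <- words I n) x = x *+ (#|I| ^ n).
Proof. by rewrite big_const_seq count_predT size_words iter_addr_0. Qed.

Arguments words : simpl never.

Section Criterion.
Local Open Scope sesquilinear_scope.
Variables (gT : finGroupType) (I : finType) (s : I -> gT) (opp : I -> I).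
Hypothesis oppK : involutive opp.
Hypothesis sopp : forall i, s (opp i) = (s i)^-1%g.
Hypothesis I_gt0 : (0 < #|I|)%N.
Local Notation N := #|gT|.
Local Notation G := [set: gT]%G.
Local Notation J := (onesmx gT).
Implicit Types (v : 'rV[algC]_N) (A : {set gT}).

Definition walkmx : 'M[algC]_N := #|I|%:R^-1 *: \sum_i regmx (s i).
(** [N%:R^-1 *: J] is the orthogonal projection onto the constants, so this is the walk restricted
    to mean-zero functions and extended by 0. *)
Definition walkmx0 : 'M[algC]_N := walkmx - N%:R^-1 *: J.

Let I_neq0 : #|I|%:R != 0 :> algC.
Proof. by rewrite pnatr_eq0 -lt0n. Qed.
Let N0 : N%:R != 0 :> algC := N_neq0 gT.

Lemma walkmxX n :
  walkmx ^+ n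
  = (#|I|%:R ^+ n)^-1 *: \sum_(w <- words I n) regmx (\prod_(i <- w) s i)%g.
Proof.
elim: n => [|n IH]; first by rewrite expr0 invr1 scale1r big_seq1 big_nil regmx1.
have -> : walkmx ^+ n.+1 = walkmx *m walkmx ^+ n by rewrite exprS.
rewrite IH big_words -scalemxAr -scalemxAl scalerA mulmx_suml.
rewrite exprSr invfM mulrC; congr (_ *: _); apply: eq_bigr => i _.
by rewrite mulmx_sumr; apply: eq_bigr => w _; rewrite big_cons regmxM.
Qed.

Lemma onesmx2 : J *m J = N%:R *: J.
Proof.
apply/matrixP => i j; rewrite !mxE.
under eq_bigr => k _ do rewrite !mxE mulr1.
by rewrite sumr_const card_ord mulr1.
Qed.

Lemma adj_onesmx : J^t* = J.
Proof. by apply/matrixP => i j; rewrite !mxE rmorph1. Qed.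

Lemma qform_onesmx v : qform J v = N%:R^-1 * qform 1%:M (v *m J).
Proof. by rewrite -qform_gram adj_onesmx onesmx2 qformZ mulKf. Qed.

Lemma walkmx_onesmx : walkmx *m J = J.
Proof.
rewrite -scalemxAl mulmx_suml; under eq_bigr => i _ do rewrite regmx_onesmx.
by rewrite sumr_const -scaler_nat scalerA mulVf // scale1r.
Qed.

Lemma onesmx_walkmx : J *m walkmx = J.
Proof.
rewrite -scalemxAr mulmx_sumr; under eq_bigr => i _ do rewrite onesmx_regmx.
by rewrite sumr_const -scaler_nat scalerA mulVf // scale1r.
Qed.

(** The walk fixes [J] on both sides, so the projection onto constants splits off. The exponent is
    positive because at exponent 0 both powers are the identity. *)
Lemma walkmx0X n : walkmx0 ^+ n.+1 = walkmx ^+ n.+1 - N%:R^-1 *: J.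
Proof.
elim: n => [|n IH]; first by rewrite !expr1.
have JX m : J *m walkmx ^+ m = J.
  elim: m => [|m IHm]; first by rewrite expr0 [LHS]mulmx1.
  by rewrite exprS [X in J *m X]/(walkmx *m _) mulmxA onesmx_walkmx.
have -> : walkmx0 ^+ n.+2 = walkmx0 *m walkmx0 ^+ n.+1 by rewrite exprS.
have -> : walkmx ^+ n.+2 = walkmx *m walkmx ^+ n.+1 by rewrite exprS.
rewrite IH /walkmx0.
move: walkmx walkmx_onesmx JX => W WJ JX; rewrite mulmxBl !mulmxBr.
rewrite -!scalemxAl -!scalemxAr WJ JX onesmx2.
by rewrite scalerK ?unitfE // subrr subr0.
Qed.

Lemma adj_walkmx : walkmx^t* = walkmx.
Proof.
rewrite /walkmx linearZ /= map_mxZ fmorphV rmorph_nat; congr (_ *: _).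
rewrite raddf_sum raddf_sum [RHS](reindex_inj (inv_inj oppK)) /=.
by apply: eq_bigr => i _; rewrite adj_regmx sopp.
Qed.

Lemma adj_walkmx0 : walkmx0^t* = walkmx0.
Proof.
by rewrite adjmxB adj_walkmx linearZ /= map_mxZ fmorphV rmorph_nat adj_onesmx.
Qed.

Lemma qform_sub_regmx g v :
  qform 1%:M (v - v *m regmx g)
  = 2 * qform 1%:M v - qform (regmx g) v - qform (regmx g^-1) v.
Proof.
have -> : v - v *m regmx g = v *m (1%:M - regmx g) by rewrite mulmxBr mulmx1.
rewrite -qform_gram adjmxB adjmx1 adj_regmx.
rewrite mulmxBl !mulmxBr !mul1mx mulmx1 -regmxM mulgV regmx1 !qformB; ring.
Qed.

(** The Dirichlet form of the walk. The involution [opp] equates the sums of the two cross terms,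
    for s and for s^-1. *)
Lemma qform_sub_walkmx v :
  qform 1%:M v - qform walkmx v
  = (2 * #|I|%:R)^-1 * \sum_i qform 1%:M (v - v *m regmx (s i)).
Proof.
under eq_bigr => i _ do rewrite qform_sub_regmx.
have sumV : \sum_i qform (regmx (s i)^-1) v = \sum_i qform (regmx (s i)) v.
  by rewrite [RHS](reindex_inj (inv_inj oppK)); apply: eq_bigr => i _; rewrite sopp.
rewrite !sumrB sumV sumr_const -mulr_natl qformZ qform_sum.
by field.
Qed.

Lemma walkmx0_contraction v : qform walkmx0 v <= qform 1%:M v.
Proof.
rewrite -subr_ge0 qformB opprD addrA opprK qform_sub_walkmx qformZ qform_onesmx.
rewrite addr_ge0 // !mulr_ge0 ?invr_ge0 ?mulr_ge0 ?ler0n ?qform1_ge0 //.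
by apply: sumr_ge0 => i _; apply: qform1_ge0.
Qed.

Section Averaging.
Variables (kappa eta : algC) (n : nat).
Hypothesis kappa0 : 0 <= kappa.
Hypothesis chi_small : forall (i : Iirr G) g, i != 0 -> g != 1%g ->
  `|'chi_i g| <= kappa * 'chi_i 1%g.
Hypothesis few_trivial :
  (\sum_(w <- words I n.+1) (\prod_(i <- w) s i == 1)%g)%N%:R <= eta * #|I|%:R ^+ n.+1.

(** Expand the power over words and apply [class_average_gap] to each product: with ratio 1 for the
    words of trivial product, a proportion of at most eta, and with ratio kappa for the others. *)
Lemma averaged_walk_small v :
  `|qform (\sum_x (regmx x *m walkmx0 ^+ n.+1 *m regmx x^-1)) v|
  <= N%:R * (eta + kappa) * qform 1%:M v.
Proof.
have -> : \sum_x (regmx x *m walkmx0 ^+ n.+1 *m regmx x^-1)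
   = (#|I|%:R ^+ n.+1)^-1 *: \sum_(w <- words I n.+1)
      (\sum_x regmx (x * (\prod_(i <- w) s i) * x^-1)%g - J).
  rewrite walkmx0X walkmxX sumrB sum_words_const exchange_big scalerBr -scaler_nat.
  rewrite scalerA natrX mulVf ?expf_neq0 // scale1r [in RHS]scaler_sumr.
  rewrite [X in _ = _ - X](_ : J = \sum_(x : gT) N%:R^-1 *: J); last first.
    by rewrite sumr_const -scaler_nat scalerA divff // scale1r.
  rewrite -sumrB; apply: eq_bigr => x _.
  rewrite mulmxBr mulmxBl -!scalemxAr -!scalemxAl regmx_onesmx onesmx_regmx.
  congr (_ *: _ - _); rewrite mulmx_sumr mulmx_suml; apply: eq_bigr => w _.
  by rewrite !regmxM.
rewrite qformZ normrM normfV normrX normr_nat qform_sum.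
have -> : N%:R * (eta + kappa) * qform 1%:M v
  = (#|I|%:R ^+ n.+1)^-1 * (N%:R * (eta * #|I|%:R ^+ n.+1 + kappa * #|I|%:R ^+ n.+1)
      * qform 1%:M v).
  by field; rewrite expf_neq0.
rewrite ler_wpM2l ?invr_ge0 ?exprn_ge0 ?ler0n //.
apply: le_trans (ler_norm_sum _ _ _) _.
apply: (@le_trans _ _ (\sum_(w <- words I n.+1)
   N%:R * ((\prod_(i <- w) s i == 1)%g%:R + kappa) * qform 1%:M v)).
  apply: ler_sum => w _; case: eqP => [->|/eqP w1]; last first.
    by rewrite add0r; apply: class_average_gap => // i i0; apply: chi_small.
  apply: (@le_trans _ _ (N%:R * 1 * qform 1%:M v)).
    apply: class_average_gap => // i _.
    by rewrite mul1r ger0_norm // ltW ?irr1_gt0.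
  by rewrite ler_wpM2r ?qform1_ge0 // ler_wpM2l ?ler0n // lerDl.
rewrite -mulr_suml -mulr_sumr ler_wpM2r ?qform1_ge0 // ler_wpM2l ?ler0n //.
rewrite big_split /= lerD //; first by rewrite -natr_sum.
by rewrite sum_words_const -[_ *+ (_ ^ _)]mulr_natr natrX.
Qed.

Definition indrow A : 'rV[algC]_N := \row_i (enum_val i \in A)%:R.

Lemma indrow_regmx A g : indrow A *m regmx g = indrow (A :* g)%g.
Proof.
apply/rowP => j; rewrite !mxE.
under eq_bigr => i _ do rewrite !mxE -natrM mulnb.
rewrite (big_enum_valT (fun x => ((x \in A) && (enum_val j == x * g)%g)%:R)).
rewrite (bigD1 (enum_val j * g^-1)%g) //= mulgKV eqxx andbT big1 ?addr0 => [|x xj].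
  by rewrite mem_rcoset.
case: eqP => [jx|_]; rewrite ?andbF //.
by case/eqP: xj; rewrite jx mulgK.
Qed.

Lemma card_sum_mem (D : {set gT}) : #|D|%:R = \sum_x (x \in D)%:R :> algC.
Proof.
by rewrite -sum1_card natr_sum big_mkcond; apply: eq_bigr => x _; case: (x \in D).
Qed.

Lemma qform_indrow_sub A B :
  qform 1%:M (indrow A - indrow B) = (#|A :\: B| + #|B :\: A|)%:R.
Proof.
rewrite qform1E.
under eq_bigr => i _ do rewrite !mxE.
rewrite (big_enum_valT (fun x => `|(x \in A)%:R - (x \in B)%:R| ^+ 2)).
rewrite natrD !card_sum_mem -big_split /=.
apply: eq_bigr => x _; rewrite !inE.
by case: (x \in A); case: (x \in B);
   rewrite /= ?subrr ?subr0 ?sub0r ?normrN ?normr0 ?normr1 ?expr0n ?expr1n ?addr0 ?add0r.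
Qed.

Lemma card_rcosetD A g : #|A :\: (A :* g)%g| = #|(A :* g)%g :\: A|.
Proof. by apply/eqP; rewrite !cardsD card_rcoset setIC. Qed.

(* [xs] is chosen so that the product of the conjugates of the spectral projection
   of the walk has small Hilbert-Schmidt norm; [A] is then tested through its
   indicator made orthogonal to the constants. *)
Lemma conjugates_expand (theta : algC) (j : nat) :
    0 < theta < 1 -> odd n ->
    ((eta + kappa) / theta ^+ n.+1) ^+ j * N%:R <= 4^-1 ->
  exists2 xs : seq gT, size xs = j &
    forall A (b : nat), (#|A|.*2 <= N)%N ->
      (forall x i, x \in xs -> (#|(A :* (x * s i * x^-1))%g :\: A| <= b)%N) ->
      (1 - theta) * #|A|%:R <= 2 ^+ (j + 4) * b%:R.
Proof.
move=> tht oddn small.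
have eta0 : 0 <= eta.
  by rewrite -(pmulr_lge0 _ (exprn_gt0 n.+1 (_ : 0 < #|I|%:R))) ?ltr0n //
     (le_trans _ few_trivial) ?ler0n.
have /andP[t0 t1] := tht.
have tn0 : 0 < theta ^+ n.+1 by rewrite exprn_gt0.
have [|P [Padj Pidem Pgap Ple]] :=
  spectral_cut adj_walkmx0 walkmx0_contraction tht (_ : ~~ odd n.+1).
  by rewrite /= negbK.
pose Q x := regmx x *m P *m regmx x^-1.
have Qadj x : (Q x)^t* = Q x.
  by rewrite /Q !adjmxM !adj_regmx invgK Padj mulmxA.
have Qidem x : Q x *m Q x = Q x.
  rewrite /Q !mulmxA -[_ *m regmx x^-1 *m regmx x]mulmxA -regmxM mulVg regmx1.
  by rewrite mulmx1 -[_ *m P *m P]mulmxA Pidem.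
have qQ x v : qform (Q x) v = qform P (v *m regmx x).
  by rewrite -qform_conj adj_regmx.
(* Conjugating P <= theta^-(n+1) M^(n+1) by each x and summing reduces this to
   [averaged_walk_small]. *)
have sumQ v : qform (\sum_x Q x) v
    <= #|gT|%:R * ((eta + kappa) / theta ^+ n.+1) * qform 1%:M v.
  rewrite mulrA mulrAC ler_pdivlMr // mulrC.
  have le1 : theta ^+ n.+1 * qform (\sum_x Q x) v
      <= qform (\sum_x (regmx x *m walkmx0 ^+ n.+1 *m regmx x^-1)) v.
    rewrite !qform_sum mulr_sumr; apply: ler_sum => x _.
    by rewrite qQ -adj_regmx qform_conj.
  have ge0 : 0 <= theta ^+ n.+1 * qform (\sum_x Q x) v.
    rewrite mulr_ge0 ?(ltW tn0) // qform_sum sumr_ge0 // => x _.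
    by rewrite (qform_proj Qadj Qidem) qform1_ge0.
  by rewrite (le_trans le1) // -(ger0_norm (le_trans ge0 le1)) averaged_walk_small.
have c0 : 0 <= (eta + kappa) / theta ^+ n.+1 by rewrite divr_ge0 ?addr_ge0 // ltW.
have N_gt0 : (0 < N)%N by apply/card_gt0P; exists 1%g.
have [xs sxs trB] := proj_product_small_trace Qadj Qidem j c0 N_gt0 sumQ.
exists xs => // A b leA hb.
pose a : algC := #|A|%:R / N%:R.
have aN : a * N%:R = #|A|%:R by rewrite divfK.
have a_half : a <= 2^-1.
  rewrite ler_pdivrMr ?ltr0n // ler_pdivlMl ?ltr0n // -natrM ler_nat mul2n //.
pose v : 'rV[algC]_N := indrow A - a *: const_mx 1.
have const_reg x : (const_mx 1 : 'rV[algC]_N) *m regmx x = const_mx 1.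
  apply/rowP => i; have /matrixP/(_ i i) := onesmx_regmx x; rewrite !mxE => {2}<-.
  by apply: eq_bigr => k _; rewrite !mxE.
have v_reg x g : v *m regmx x - v *m regmx (x * g)
    = indrow (A :* x)%g - indrow (A :* (x * g))%g.
  rewrite /v !mulmxBl -!scalemxAl !const_reg !indrow_regmx.
  by rewrite opprB addrA subrK.
have vJ : v *m J = 0.
  apply/rowP => i; rewrite !mxE.
  under eq_bigr => k _ do rewrite !mxE !mulr1.
  rewrite (big_enum_valT (fun x => (x \in A)%:R - a)) sumrB sumr_const.
  by rewrite -[a *+ _]mulr_natr cardT -cardE aN -card_sum_mem subrr.
have q_v : qform 1%:M v = #|A|%:R * (1 - a).
  rewrite qform1E; under eq_bigr => i _ do rewrite !mxE mulr1.
  rewrite (big_enum_valT (fun x => `|(x \in A)%:R - a| ^+ 2)).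
  have aR : a \is Num.real by rewrite realM ?realV ?realn.
  transitivity (\sum_(x : gT) ((x \in A)%:R * (1 - 2 * a) + a ^+ 2)).
    apply: eq_bigr => x _; rewrite real_normK ?realB ?realn //.
    by case: (x \in A); rewrite ?mulr1n ?mulr0n; ring.
  rewrite big_split /= -mulr_suml sumr_const -card_sum_mem.
  rewrite -[a ^+ 2 *+ _]mulr_natr expr2 -mulrA aN; ring.
have e0 : 0 <= (1 - theta)^-1 * b%:R :> algC.
  by rewrite mulr_ge0 ?ler0n // invr_ge0 subr_ge0 ltW.
(* The drift under [Q x] is that of the translate of v by x under P, which [Pgap] bounds by the
   Dirichlet form. Each term of that form is a symmetric difference of two halves of equal size at
   most b, and the 2 cancels its prefactor. *)
have drift x : x \in xs -> qform 1%:M (v - v *m Q x) <= (1 - theta)^-1 * b%:R.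
  move=> xxs; rewrite ler_pdivlMl ?subr_gt0 // (qform_sub_proj Qadj Qidem) qQ.
  rewrite -(qform_regmx x); apply: le_trans (Pgap _) _.
  have -> : qform walkmx0 (v *m regmx x) = qform walkmx (v *m regmx x).
    rewrite qformB [qform (N%:R^-1 *: J) _]qformZ qform_onesmx -mulmxA regmx_onesmx vJ.
    rewrite [qform 1%:M 0]qform1E big1 ?mulr0 ?subr0 // => i _.
    by rewrite mxE normr0 expr0n.
  rewrite qform_sub_walkmx ler_pdivrMl ?mulr_gt0 ?ltr0n //.
  rewrite -mulrA mulrCA mulr_natl -sumr_const; apply: ler_sum => i _.
  rewrite -mulmxA -regmxM v_reg.
  have -> : indrow (A :* x)%g - indrow (A :* (x * s i))%g
     = (indrow A - indrow (A :* (x * s i * x^-1))%g) *m regmx x.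
    by rewrite mulmxBl !indrow_regmx -rcosetM mulgKV.
  rewrite qform_regmx qform_indrow_sub card_rcosetD addnn -mul2n -natrM ler_nat.
  by rewrite leq_mul2l hb.
have := proj_product_gap Qadj Qidem (le_trans trB small) e0 drift.
rewrite sxs q_v mulrCA ler_pdivlMl ?subr_gt0 // => gap.
(* As A has density at most 1/2, |v|^2 = |A| (1 - a) is at least |A| / 2. This last factor 2 turns
   the exponent j + 3 of [proj_product_gap] into j + 4. *)
have half : (1 - theta) * (#|A|%:R * 2^-1) <= (1 - theta) * (#|A|%:R * (1 - a)).
  rewrite ler_wpM2l ?subr_ge0 ?(ltW t1) // ler_wpM2l ?ler0n //.
  by rewrite lerBrDr -lerBrDl (_ : 1 - 2^-1 = 2^-1 :> algC) //; field.
have := le_trans half gap; rewrite mulrA ler_pdivrMr ?ltr0n // => /le_trans; apply.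
by rewrite addnS !addnS addn0 [in X in _ <= X]exprSr mulrAC.
Qed.

End Averaging.

End Criterion.

(** * Two-by-two matrices and PSL2 *)

Section TwoByTwo.
Variable R : comNzRingType.

Definition mx2 (a b c d : R) : 'M[R]_2 :=
  \matrix_(i, j) if i == 0 then (if j == 0 then a else b)
                 else (if j == 0 then c else d).

Lemma mx2P (M M' : 'M[R]_2) :
  M 0 0 = M' 0 0 -> M 0 1 = M' 0 1 -> M 1 0 = M' 1 0 -> M 1 1 = M' 1 1 -> M = M'.
Proof.
move=> e00 e01 e10 e11; apply/matrixP => i j.
have ordE (k : 'I_2) : k = 0 \/ k = 1.
  by case: k => [[|[|k]] kP] //; [left | right]; apply: val_inj.
by have [->|->] := ordE i; have [->|->] := ordE j.
Qed.

Lemma mulmx2E (M M' : 'M[R]_2) i j :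
  (M *m M') i j = M i 0 * M' 0 j + M i 1 * M' 1 j.
Proof.
rewrite mxE !big_ord_recl big_ord0 addr0.
by congr (_ * _ + M i _ * M' _ j); apply: val_inj.
Qed.

Lemma mulmx2 a b c d a' b' c' d' :
  mx2 a b c d *m mx2 a' b' c' d'
  = mx2 (a * a' + b * c') (a * b' + b * d') (c * a' + d * c') (c * b' + d * d').
Proof. by apply: mx2P; rewrite mulmx2E !mxE. Qed.

Lemma det_mx2E (M : 'M[R]_2) : \det M = M 0 0 * M 1 1 - M 0 1 * M 1 0.
Proof.
rewrite (expand_det_row M 0) !big_ord_recl big_ord0 addr0 /cofactor !det_mx11 !mxE /=.
rewrite expr0 mul1r expr1 mulN1r mulrN.
by congr (M _ _ * M _ _ - M _ _ * M _ _); apply: val_inj.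
Qed.

Lemma det_mx2 a b c d : \det (mx2 a b c d) = a * d - b * c.
Proof. by rewrite det_mx2E !mxE. Qed.

End TwoByTwo.

(** * The quotient map from SL2 to PSL2, and centralizers *)

Section Projection.
Variable F : finFieldType.
Implicit Types A B : 'M[F]_2.

(* [insubd] sends the singular matrices to 1; [psl] is only used at determinant 1. *)
Definition psl A : PSL2 F :=
  subg (SL2 F / 'Z(SL2 F))%G (coset 'Z(SL2 F) (insubd (1%g : {'GL_2[F]}) A)).

Let GLof A : {'GL_2[F]} := insubd (1%g : {'GL_2[F]}) A.

Let GLofE A : \det A = 1 -> GLval (GLof A) = A.
Proof. by move=> dA; rewrite /GLof /= insubdK // unfold_in /= unitmxE dA unitr1. Qed.

Let GLof_SL A : \det A = 1 -> GLof A \in SL2 F.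
Proof. by move=> dA; rewrite inE GLofE ?dA. Qed.

Let GLofM A B : \det A = 1 -> \det B = 1 -> GLof (A *m B) = (GLof A * GLof B)%g.
Proof.
move=> dA dB; apply: val_inj; rewrite [LHS]GLofE ?det_mulmx ?dA ?dB ?mulr1 //.
by rewrite [RHS]GL_ME !GLofE.
Qed.

Let SL_norm A : \det A = 1 -> GLof A \in 'N('Z(SL2 F))%g.
Proof. by move=> dA; apply: (subsetP (normal_norm (center_normal _))); apply: GLof_SL. Qed.

Lemma pslM A B : \det A = 1 -> \det B = 1 -> psl (A *m B) = (psl A * psl B)%g.
Proof.
move=> dA dB; rewrite /psl -/(GLof _) GLofM // morphM ?SL_norm //.
by rewrite subgM ?mem_quotient ?GLof_SL.
Qed.

Lemma psl_surj (x : PSL2 F) : exists2 A, \det A = 1 & psl A = x.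
Proof.
have /morphimP[u nu uSL xu] := subgP x.
have dA : \det (GLval u) = 1 by move: uSL; rewrite inE => /eqP.
exists (GLval u) => //; apply: val_inj.
rewrite /psl -/(GLof _) (_ : GLof _ = u); last by apply: val_inj; rewrite [LHS]GLofE.
by rewrite /= subgK ?mem_quotient // -xu.
Qed.

(** The centre of SL2 is scalar, since commuting with one upper and one lower unipotent already
    forces this. *)
Lemma psl_eq1 A : \det A = 1 -> (psl A == 1%g) = is_scalar_mx A.
Proof.
move=> dA; have AQ : coset 'Z(SL2 F) (GLof A) \in (SL2 F / 'Z(SL2 F))%g.
  by apply: mem_quotient; apply: GLof_SL.
have -> : (psl A == 1%g) = (GLof A \in 'Z(SL2 F)%g).
  rewrite -(inj_eq val_inj) /= subgK //.
  by apply/eqP/idP => [/coset_idr|/coset_id//]; apply; apply: SL_norm.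
apply/centerP/idP => [[_ cA]|/is_scalar_mxP[c Ac]].
  have com B : \det B = 1 -> A *m B = B *m A.
    move=> dB; have := congr1 (@GLval _ _) (cA _ (GLof_SL dB)).
    by rewrite !GL_ME !GLofE.
  have /matrixP e1 : A *m mx2 1 1 0 1 = mx2 1 1 0 1 *m A.
    by apply: com; rewrite det_mx2; ring.
  have /matrixP e2 : A *m mx2 1 0 1 1 = mx2 1 0 1 1 *m A.
    by apply: com; rewrite det_mx2; ring.
  have := e1 0 0; have := e1 0 1; have := e2 0 0.
  rewrite !mulmx2E !mxE /= => h1 h2 h3.
  have A01 : A 0 1 = 0 by apply: (addrI (A 0 0)); move: h1; rewrite !mulr1 !mul0r mul1r.
  have A10 : A 1 0 = 0.
    by apply: (addrI (A 0 0)); move: h3; rewrite mulr1 mulr0 !mul1r => <-.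
  apply/is_scalar_mxP; exists (A 0 0); apply: mx2P; rewrite !mxE //= ?A01 ?A10 //.
  by move: h2; rewrite A01 !mulr1 !mul1r addr0 add0r.
split; first exact: GLof_SL.
move=> u uSL; apply: val_inj; change (GLval (GLof A) *m GLval u = GLval u *m GLval (GLof A)).
by rewrite GLofE // Ac scalar_mxC.
Qed.

Lemma psl_inv A : \det A = 1 -> (psl A)^-1%g = psl (invmx A).
Proof.
move=> dA; have uA : A \in unitmx by rewrite unitmxE dA unitr1.
apply: (mulgI (psl A)); rewrite mulgV -pslM ?det_inv ?dA ?invr1 // mulmxV //.
by apply/esym/eqP; rewrite psl_eq1 ?det1 ?scalar_mx_is_scalar.
Qed.


Definition sl_commutant A : {set 'M[F]_2} :=
  [set B | (\det B == 1) && (A *m B == B *m A)].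

Lemma card_quadratic_roots (b c : F) : (#|[set y | (y ^+ 2 + b * y + c == 0)%R]| <= 2)%N.
Proof.
have [-> | [y0]] := set_0Vmem [set y | y ^+ 2 + b * y + c == 0]; first by rewrite cards0.
rewrite inE => /eqP y0P; apply: (@leq_trans #|[set y0; - b - y0]|); last first.
  by rewrite cards2; case: (_ != _).
apply/subset_leq_card/subsetP => y; rewrite !inE => /eqP yP.
rewrite -subr_eq0 -[y == _]subr_eq0 -mulf_eq0; apply/eqP.
rewrite (_ : _ * _ = (y ^+ 2 + b * y + c) - (y0 ^+ 2 + b * y0 + c)); last by ring.
by rewrite yP y0P subrr.
Qed.

(** Commuting with a non-scalar matrix is a linear condition leaving two free entries, and
    determinant 1 is then a quadratic equation for one of them given the other: at most two roots
    for each of q values. *)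
Lemma card_sl_commutant A : ~~ is_scalar_mx A -> (#|sl_commutant A| <= 2 * #|F|)%N.
Proof.
have offdiag (M : 'M[F]_2) : M 0 1 != 0 -> (#|sl_commutant M| <= 2 * #|F|)%N.
  (* With x = B 0 1 and y = B 1 1, commuting forces B 0 0 = y + k x and B 1 0 = m x; [pairs]
     collects the solutions (x, y) of det B = 1. *)
  move=> M01; pose k := (M 0 0 - M 1 1) / M 0 1; pose m := M 1 0 / M 0 1.
  pose pairs :=
    \bigcup_x (pair x @: [set y | y ^+ 2 + (x * k) * y + (- (x ^+ 2 * m) - 1) == 0]).
  have le_pairs : (#|pairs| <= 2 * #|F|)%N.
    rewrite mulnC -sum_nat_const /pairs.
    elim/big_ind2: _ => [|X1 n1 X2 n2 le1 le2|x _]; first by rewrite cards0.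
      by apply: leq_trans (leq_card_setU _ _) _; apply: leq_add.
    by apply: leq_trans (leq_imset_card _ _) _; apply: card_quadratic_roots.
  have detB B : B \in sl_commutant M ->
      [/\ B 0 0 = B 1 1 + B 0 1 * k, B 1 0 = B 0 1 * m & \det B = 1].
    rewrite inE => /andP[/eqP dB /eqP /matrixP com].
    have := com 0 0; have := com 0 1; rewrite !mulmx2E => h1 h2; split=> //.
    - apply: (mulIf M01); rewrite mulrDl /k -!mulrA mulVf // mulr1.
      apply: (addIr (B 0 1 * M 1 1)); rewrite -h1; ring.
    - apply: (mulIf M01); rewrite /m -!mulrA mulVf // mulr1.
      apply: (addrI (B 0 0 * M 0 0)); rewrite -h2; ring.
  rewrite -(card_in_imset (f := fun B => (B 0 1, B 1 1))).
    apply: leq_trans le_pairs; apply/subset_leq_card/subsetP => _ /imsetP[B BM ->].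
    have [b00 b10 dB] := detB B BM.
    apply/bigcupP; exists (B 0 1) => //; apply/imsetP; exists (B 1 1) => //.
    rewrite inE; apply/eqP; move: dB; rewrite det_mx2E b00 b10 => <-; ring.
  move=> B B' /detB[b00 b10 _] /detB[b00' b10' _] [e01 e11].
  by apply: mx2P => //; rewrite ?b00 ?b10 ?b00' ?b10' e01 ?e11.
move=> nsA; have [A01|/offdiag//] := eqVneq (A 0 1) 0.
have [A10|A10] := eqVneq (A 1 0) 0; last first.
  rewrite -(card_imset _ (@trmx_inj _ _ _));
  apply: leq_trans (offdiag A^T _); last by rewrite mxE.
  apply/subset_leq_card/subsetP => _ /imsetP[B + ->]; rewrite !inE det_tr.
  move=> /andP[-> /eqP com].
  by rewrite -!trmx_mul com eqxx.
(* What remains is a diagonal [A] with distinct entries; its commutant is diagonal and determined by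
   one entry. *)
have A0011 : A 0 0 != A 1 1.
  apply: contra nsA => /eqP e; apply/is_scalar_mxP; exists (A 0 0).
  by apply: mx2P; rewrite !mxE //= ?A01 ?A10.
have diagB B : B \in sl_commutant A -> [/\ B 0 1 = 0, B 1 0 = 0 & B 0 0 * B 1 1 = 1].
  rewrite inE => /andP[/eqP dB /eqP /matrixP com].
  have := com 0 1; have := com 1 0; rewrite !mulmx2E A01 A10 => h1 h2.
  have d0 : A 0 0 - A 1 1 != 0 by rewrite subr_eq0.
  have b01 : B 0 1 = 0.
    apply: (mulIf d0); rewrite mul0r mulrBr.
    apply/eqP; rewrite subr_eq0; apply/eqP; move: h2.
    by rewrite !mul0r mulr0 addr0 add0r mulrC.
  have b10 : B 1 0 = 0.
    apply: (mulIf d0); rewrite mul0r mulrBr.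
    apply/eqP; rewrite subr_eq0; apply/eqP; move: h1.
    by rewrite !mul0r mulr0 addr0 add0r mulrC.
  by split=> //; move: dB; rewrite det_mx2E b01 mul0r subr0.
rewrite -(card_in_imset (f := fun B => B 0 0)).
  by apply: leq_trans (max_card _) _; rewrite leq_pmull.
move=> B B' /diagB[b01 b10 e] /diagB[b01' b10' e'] e00.
have B00 : B 0 0 != 0 by apply: contra_eq_neq e => ->; rewrite mul0r eq_sym oner_eq0.
apply: mx2P; rewrite ?b01 ?b10 ?b01' ?b10' //.
by apply: (mulfI B00); rewrite e e00.
Qed.

(** Commuting modulo scalars means A B = c B A, and determinants give c^2 = 1. Both signs contribute
    at most 2q matrices: multiplication by a fixed anticommuting one injects [anti] into the
    commutant. *)
Lemma card_cent_psl (g : PSL2 F) :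
  g != 1%g -> (#|'C_([set: PSL2 F])[g]%g| <= 4 * #|F|)%N.
Proof.
have [A dA <-] := psl_surj g; rewrite psl_eq1 // => nsA.
pose anti := [set B : 'M[F]_2 | (\det B == 1) && (A *m B == - (B *m A))].
have le_anti : (#|anti| <= #|sl_commutant A|)%N.
  have [-> | [B0]] := set_0Vmem anti; first by rewrite cards0.
  rewrite inE => /andP[/eqP dB0 /eqP aB0].
  have uB0 : B0 \in unitmx by rewrite unitmxE dB0 unitr1.
  rewrite -(card_imset _ (can_inj (mulmxK uB0))); apply/subset_leq_card/subsetP.
  move=> _ /imsetP[B + ->]; rewrite !inE => /andP[/eqP dB /eqP aB].
  rewrite det_mulmx dB dB0 mulr1 eqxx /=.
  by rewrite mulmxA aB mulNmx -!mulmxA aB0 mulmxN opprK.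
apply: (@leq_trans #|psl @: (sl_commutant A :|: anti)|).
  apply/subset_leq_card/subsetP => y; have [B dB <-] := psl_surj y.
  rewrite in_setI in_setT /= => /cent1P com; apply/imsetP; exists B => //.
  rewrite in_setU !inE dB eqxx /=.
  have dAB : \det (A *m B) = 1 by rewrite det_mulmx dA dB mulr1.
  have dBA : \det (B *m A) = 1 by rewrite det_mulmx dA dB mulr1.
  have uBA : B *m A \in unitmx by rewrite unitmxE dBA unitr1.
  have : is_scalar_mx (A *m B *m invmx (B *m A)).
    rewrite -psl_eq1; last by rewrite det_mulmx det_inv dAB dBA invr1 mulr1.
    by rewrite pslM ?det_inv ?dBA ?invr1 // -psl_inv // !pslM // com mulgV.
  case/is_scalar_mxP=> c /(congr1 (mulmx^~ (B *m A))); rewrite mulmxKV // mul_scalar_mx => e.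
  have : c ^+ 2 == 1.
    by have := congr1 determinant e; rewrite dAB detZ dBA mulr1 => <-.
  rewrite -subr_eq0 subr_sqr_1 mulf_eq0 subr_eq0 addr_eq0 => /orP[]/eqP ce.
    by rewrite e ce scale1r eqxx.
  by rewrite e ce scaleN1r eqxx orbT.
apply: leq_trans (leq_imset_card _ _) _; apply: leq_trans (leq_card_setU _ _) _.
have le1 := card_sl_commutant nsA.
by apply: leq_trans (leq_add le1 (leq_trans le_anti le1)) _; rewrite -mulnDl.
Qed.

End Projection.

(** * Character ratios of PSL2 *)

Lemma irr_cfker_full (gT : finGroupType) (G : {group gT}) (i : Iirr G) :
  G \subset cfker 'chi_i -> i = 0.
Proof.
move=> kerG; have chiE : 'chi_i = 'chi_i 1%g *: 'chi_0.
  apply/cfun_inP => x Gx; rewrite cfunE irr0 cfun1E Gx mulr1.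
  by have := subsetP kerG _ Gx; rewrite cfkerEchar ?irr_char // inE => /andP[_ /eqP].
apply/eqP; apply: contraT => i0; have := cfdot_irr i 0.
rewrite (negPf i0) {1}chiE cfdotZl cfnorm_irr mulr1 => /eqP.
by rewrite (negPf (irr1_neq0 i)).
Qed.

Section DegreeBound.
Variables (gT : finGroupType) (G : {group gT}).

(* Frobenius: [T] permutes the linear constituents of the restriction to [U], and the
   conjugates of a nontrivial one are pairwise distinct. *)
Lemma irr1_ge_torus (U : {group gT}) (T : {set gT}) (i : Iirr G) :
    U \subset G -> T \subset G -> T \subset 'N(U)%g -> abelian U ->
    {in T &, forall a b, a != b ->
      {in U, forall u, exists2 v, v \in U & u = (v ^ a^-1 * (v ^ b^-1)^-1)%g}} ->
    ~~ (U \subset cfker 'chi_i) ->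
  #|T|%:R <= 'chi_i 1%g.
Proof.
move=> sUG sTG nUT abU sep nker.
pose theta := 'Res[U] 'chi_i.
have thetaC : theta \is a character by rewrite cfRes_char ?irr_char.
(* If only the trivial character occurred in the restriction, [U] would lie in the kernel. *)
have [j jtheta j0] : exists2 j, j \in irr_constt theta & j != 0.
  apply/exists_inP; apply: contraR nker; rewrite negb_exists_in => /forall_inP all0.
  have := cfker_Res sUG (irr_char i); rewrite cfkerE // (setIidPl _).
    by move=> kerE; apply/setIidPl.
  apply/bigcapsP => j jtheta; have := all0 j jtheta; rewrite negbK => /eqP->.
  by rewrite cfker_irr0.
have linj : 'chi_j \is a linear_char by apply/char_abelianP.
pose f a := conjg_Iirr j a.
have fT a : a \in T -> f a \in irr_constt theta.
  move=> aT; have aG := subsetP sTG _ aT; have aN := subsetP nUT _ aT.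
  have -> : theta = (theta ^ a)%CF.
    apply/cfun_inP => x xU; rewrite cfConjgE // !cfResE ?cfunJ ?groupV //.
    by rewrite memJ_norm ?groupV.
  by rewrite irr_consttE conjg_IirrE cfConjg_iso -irr_consttE.
(* If two conjugates agreed, j would be trivial on every quotient of v ^ a^-1 by v ^ b^-1, and by
   [sep] these exhaust [U]. *)
have finj : {in T &, injective f}.
  move=> a b aT bT fab; apply/eqP; apply: contraT => ab.
  have aN := subsetP nUT _ aT; have bN := subsetP nUT _ bT.
  case/negP: j0; apply/eqP/irr_cfker_full/subsetP => u uU.
  have [v vU ->] := sep _ _ aT bT ab _ uU.
  have vaU : (v ^ a^-1)%g \in U by rewrite memJ_norm ?groupV.
  have vbU : (v ^ b^-1)%g \in U by rewrite memJ_norm ?groupV.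
  rewrite cfkerEirr inE lin_charM ?groupV // lin_charV //.
  have := congr1 (fun k => 'chi_k v) fab; rewrite !conjg_IirrE !cfConjgE // => ->.
  by rewrite mulfV ?lin_char_neq0 // lin_char1.
have -> : 'chi_i 1%g = theta 1%g by rewrite cfRes1.
rewrite [theta]cfun_sum_constt sum_cfunE -(card_in_imset finj) -sumr_const.
have sub : f @: T \subset irr_constt theta.
  by apply/subsetP => _ /imsetP[a aT ->]; apply: fT.
rewrite big_mkcond [X in _ <= X]big_mkcond; apply: ler_sum => k _.
(* Multiplicity and degree are positive integers, so each constituent adds at least 1 to the
   degree. *)
have c_ge1 : k \in irr_constt theta -> 1 <= ('[theta, 'chi_k] *: 'chi_k) 1%g.
  rewrite irr_consttE cfunE => ck.
  have /natrP[m cm] := Cnat_cfdot_char_irr k thetaC; have /natrP[d dm] := Cnat_irr1 k.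
  rewrite cm dm -natrM ler1n muln_gt0 !lt0n -!(pnatr_eq0 algC) -cm -dm ck.
  exact: irr1_neq0.
case: ifP => [kT|_]; first by rewrite (subsetP sub _ kT) c_ge1 // (subsetP sub).
by case: ifP => // /c_ge1; apply: le_trans.
Qed.
End DegreeBound.

Section PSLCharacters.
Variable F : finFieldType.
Local Notation G := [set: PSL2 F]%G.

Let upper (b : F) : 'M[F]_2 := mx2 1 b 0 1.
Let torus (a : F) : 'M[F]_2 := mx2 a 0 0 a^-1.

Let det_upper b : \det (upper b) = 1.
Proof. by rewrite det_mx2; ring. Qed.

Let det_torus (a : F) : a != 0 -> \det (torus a) = 1.
Proof. by move=> a0; rewrite det_mx2 divff // mul0r subr0. Qed.

Let upperD b c : upper b *m upper c = upper (b + c).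
Proof. by rewrite mulmx2; congr mx2; ring. Qed.

Let upper0 : upper 0 = 1%:M.
Proof. by apply: mx2P; rewrite !mxE. Qed.

Let psl_id : psl (1%:M : 'M[F]_2) = 1%g.
Proof. by apply/eqP; rewrite psl_eq1 ?det1 ?scalar_mx_is_scalar. Qed.

Let psl_upperN b : psl (upper (- b)) = (psl (upper b))^-1%g.
Proof.
by apply: (mulgI (psl (upper b))); rewrite mulgV -pslM // upperD subrr upper0 psl_id.
Qed.

Let psl_torusV (a : F) : a != 0 -> psl (torus a^-1) = (psl (torus a))^-1%g.
Proof.
move=> a0; apply: (mulgI (psl (torus a))); rewrite mulgV -pslM ?det_torus ?invr_neq0 //.
rewrite -psl_id /torus mulmx2 invrK; congr psl.
by apply: mx2P; rewrite !mxE /= ?mulr0 ?mul0r ?addr0 ?add0r ?divff ?mulVf.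
Qed.

(** The Weyl element conjugates upper unipotents to lower ones, and a matrix with nonzero lower left
    entry is a product upper-lower-upper. Otherwise, multiplying by a lower unipotent makes that
    entry A 1 1, which is nonzero. *)
Lemma psl_normal_closure (K : {group PSL2 F}) :
  (K <| G)%g -> (forall b, psl (mx2 1 b 0 1) \in K) -> K :=: G.
Proof.
move=> nKG hU; apply/eqP; rewrite eqEsubset (normal_sub nKG) /=.
have nK x y : x \in K -> (x ^ y)%g \in K.
  by move=> xK; rewrite memJ_norm // (subsetP (normal_norm nKG)) ?inE.
pose w : 'M[F]_2 := mx2 0 1 (-1) 0.
have dw : \det w = 1 by rewrite det_mx2; ring.
have dlow c : \det (mx2 1 0 c 1 : 'M[F]_2) = 1 by rewrite det_mx2; ring.
have low c : psl (mx2 1 0 c 1) \in K.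
  have -> : psl (mx2 1 0 c 1) = (psl (upper (- c)) ^ psl w)%g.
    have e : w *m mx2 1 0 c 1 = upper (- c) *m w.
      by rewrite /w !mulmx2; apply: mx2P; rewrite !mxE /=; ring.
    by apply: (mulgI (psl w)); rewrite -conjgC -!pslM // e.
  exact/nK/hU.
have low_nz A : \det A = 1 -> A 1 0 != 0 -> psl A \in K.
  move=> dA c0.
  have -> : A = upper ((A 0 0 - 1) / A 1 0)
      *m mx2 1 0 (A 1 0) 1 *m upper ((A 1 1 - 1) / A 1 0).
    have b01 : A 0 1 = (A 0 0 * A 1 1 - 1) / A 1 0.
      by apply: (mulIf c0); rewrite divfK // -dA det_mx2E; ring.
    by rewrite !mulmx2; apply: mx2P; rewrite !mxE /= ?b01; field.
  have dul x c : \det (upper x *m mx2 1 0 c 1) = 1.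
    by rewrite det_mulmx dlow det_upper mulr1.
  rewrite (pslM (dul _ _) (det_upper _)) (pslM (det_upper _) (dlow _)).
  by apply: groupM; [apply: groupM; [exact: hU | exact: low] | exact: hU].
apply/subsetP => x _; have [A dA <-] := psl_surj x.
have [c0|/low_nz] := eqVneq (A 1 0) 0; last exact.
have d0 : A 1 1 != 0.
  by apply: contra_eq_neq dA => d0; rewrite det_mx2E c0 d0 !mulr0 subrr eq_sym oner_eq0.
rewrite -(groupMr _ (low 1)) -pslM // low_nz ?det_mulmx ?dA ?dlow ?mulr1 //.
by rewrite mulmx2E !mxE /= c0 !mulr1 add0r.
Qed.

(** [irr1_ge_torus] for the upper unipotents and the diagonal torus. The torus element of a scales
    the unipotent parameter by a^2, and the torus loses at most a factor 2 in PSL2, where a and -a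
    coincide. *)
Lemma psl_irr1_ge (i : Iirr G) : i != 0 -> (#|F| - 1)%:R <= 2 * 'chi_i 1%g.
Proof.
move=> i0.
have U_group : group_set [set psl (upper b) | b : F].
  apply/group_setP; split=> [|_ _ /imsetP[b _ ->] /imsetP[c _ ->]].
    by apply/imsetP; exists 0; rewrite // upper0 psl_id.
  by rewrite -pslM // upperD; apply/imsetP; exists (b + c).
pose U := Group U_group; pose T := [set psl (torus a) | a in [set~ 0]].
have torusJ (a b : F) : a != 0 ->
    (psl (upper b) ^ (psl (torus a))^-1)%g = psl (upper (b * a ^+ 2)).
  move=> a0; rewrite -psl_torusV //; have ai0 : a^-1 != 0 by rewrite invr_neq0.
  have e : upper b *m torus a^-1 = torus a^-1 *m upper (b * a ^+ 2).
    by rewrite /torus !mulmx2; congr mx2; field; rewrite ?a0 ?oner_eq0.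
  have da := det_torus ai0.
  by apply: (mulgI (psl (torus a^-1))); rewrite -conjgC -!pslM // e.
have cardT : (#|F| - 1 <= 2 * #|T|)%N.
  have -> : (#|F| - 1 = #|[set~ (0%R : F)]|)%N by rewrite cardsC1 subn1.
  rewrite -sum1_card (partition_big_imset (fun a => psl (torus a))) /= mulnC -sum_nat_const.
  apply: leq_sum => _ /imsetP[a0 + ->]; rewrite !inE => a0_neq0.
  apply: (@leq_trans #|[set a0; - a0]|); last by rewrite cards2; case: (_ != _).
  rewrite sum1_card; apply/subset_leq_card/subsetP => a; rewrite unfold_in !inE.
  move=> /andP[a_neq0 /eqP faa0].
  have : psl (torus a *m torus a0^-1) == 1%g.
    by rewrite pslM ?det_torus ?invr_neq0 // psl_torusV // faa0 mulgV.
  rewrite psl_eq1 ?det_mulmx ?det_torus ?mulr1 ?invr_neq0 //.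
  case/is_scalar_mxP=> c; rewrite /torus mulmx2 => /matrixP e.
  have e0 : a / a0 = c by have := e 0 0; rewrite !mxE /= mulr0 addr0 mulr1n.
  have e1 : a0 / a = c.
    by have := e 1 1; rewrite !mxE /= mulr0 add0r mulr1n invrK mulrC.
  have : a ^+ 2 = a0 ^+ 2.
    rewrite (_ : a ^+ 2 = a * a0 * (a / a0)); last by field.
    by rewrite e0 -e1; field.
  by move/eqP; rewrite -subr_eq0 subr_sqr mulf_eq0 subr_eq0 addr_eq0.
have leT : #|T|%:R <= 'chi_i 1%g.
  apply: (@irr1_ge_torus _ _ U).
  - exact: subsetT.
  - exact: subsetT.
  - apply/subsetP => _ /imsetP[a + ->]; rewrite in_setC1 => a0.
    rewrite -groupV inE; apply/subsetP => _ /imsetP[_ /imsetP[b _ ->] ->].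
    by rewrite torusJ //; apply/imsetP; exists (b * a ^+ 2).
  - apply/centsP => _ /imsetP[b _ ->] _ /imsetP[c _ ->].
    by rewrite /commute -!pslM // !upperD addrC.
  - move=> _ _ /imsetP[a + ->] /imsetP[b + ->]; rewrite !in_setC1.
    move=> a0 b0 ab _ /imsetP[c _ ->].
    have ab2 : a ^+ 2 - b ^+ 2 != 0.
      apply: contra ab; rewrite subr_sqr mulf_eq0 subr_eq0 addr_eq0 => /orP[]/eqP-> //.
      apply/eqP/(mulIg (psl (torus b))^-1%g); rewrite mulgV -psl_torusV //.
      rewrite -pslM ?det_torus ?invr_neq0 ?oppr_eq0 //.
      apply/eqP; rewrite psl_eq1; last first.
        by rewrite det_mulmx !det_torus ?mulr1 ?invr_neq0 ?oppr_eq0.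
      apply/is_scalar_mxP; exists (-1); rewrite /torus mulmx2.
      apply: mx2P; rewrite !mxE /= ?mulr0 ?mul0r ?addr0 ?add0r ?mulr0n ?mulr1n //.
        by field.
      by field; rewrite oppr_eq0 b0 oner_eq0.
    (* The parameter solves v a^2 - v b^2 = c, possible since distinct torus images have distinct
       squares. *)
    exists (psl (upper (c / (a ^+ 2 - b ^+ 2)))).
      by apply/imsetP; exists (c / (a ^+ 2 - b ^+ 2)).
    rewrite !torusJ // -psl_upperN -pslM // upperD; congr (psl (upper _)).
    by field.
  - apply: contra i0 => kerU; apply/eqP/irr_cfker_full.
    rewrite (psl_normal_closure (cfker_normal 'chi_i)) // => b.
    by apply: (subsetP kerU); apply/imsetP; exists b.
apply: (@le_trans _ _ (2 * #|T|%:R)); first by rewrite -natrM ler_nat.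
by rewrite ler_wpM2l.
Qed.

(** Second orthogonality gives |chi(g)|^2 <= |C(g)| <= 4q, and chi(1) >= (q - 1)/2 >= q/4, so the
    ratio is at most 8 / sqrt q. The computation is done on squares. *)
Lemma psl_character_ratio (i : Iirr G) (g : PSL2 F) r :
    (16 ^ r <= #|F|)%N -> i != 0 -> g != 1%g ->
  `|'chi_i g| <= 8 / 4 ^+ r * 'chi_i 1%g.
Proof.
move=> leq i0 g1.
have q2 : (2 <= #|F|)%N.
  by rewrite (cardD1 0) (cardD1 1) !inE oner_eq0.
have h1 : `|'chi_i g| ^+ 2 <= 4 * #|F|%:R.
  have := second_orthogonality_relation g (in_setT g).
  rewrite class_refl mulr1n => E.
  apply: (@le_trans _ _ (#|('C_([set: PSL2 F])[g])%g|%:R)); last first.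
    by rewrite -natrM ler_nat card_cent_psl.
  rewrite -E (bigD1 i) //= -normCK lerDl; apply: sumr_ge0 => j _.
  by rewrite -normCK exprn_ge0.
have h2 : #|F|%:R <= 4 * 'chi_i 1%g.
  apply: (@le_trans _ _ (2 * (#|F| - 1)%:R)).
    by rewrite -natrM ler_nat; lia.
  by rewrite (_ : 4 = 2 * 2) -?mulrA ?ler_wpM2l ?psl_irr1_ge // -natrM.
have r0 : 0 < 4 ^+ r :> algC by rewrite exprn_gt0.
have c0 : 0 <= 'chi_i 1%g by rewrite ltW ?irr1_gt0.
have k0 : 0 <= 8 / 4 ^+ r :> algC by rewrite divr_ge0 ?ler0n ?ltW.
rewrite -(@ler_pXn2r _ 2) ?nnegrE ?(mulr_ge0 k0 c0) ?normr_ge0 //.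
apply: le_trans h1 _; rewrite exprMn expr_div_n mulrAC ler_pdivlMr ?exprn_gt0 //.
have h3 : (4 ^+ r) ^+ 2 <= #|F|%:R :> algC.
  by rewrite -!natrX ler_nat -expnM mulnC expnM.
apply: (@le_trans _ _ (4 * #|F|%:R * #|F|%:R)).
  by rewrite ler_wpM2l // mulr_ge0.
have -> : 8 ^+ 2 * 'chi_i 1%g ^+ 2 = 4 * (4 * 'chi_i 1%g) * (4 * 'chi_i 1%g) by ring.
rewrite -[X in X <= _]mulrA -[X in _ <= X]mulrA ler_wpM2l ?ler0n //.
by rewrite ler_pM ?ler0n.
Qed.

End PSLCharacters.

(** * Words in transvections *)

Definition letter : finType := ('I_5 * bool)%type.

Definition letter_opp (l : letter) : letter := (l.1, ~~ l.2).

Lemma letter_oppK : involutive letter_opp.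
Proof. by case=> i b; rewrite /letter_opp /= negbK. Qed.

Lemma size_mem_words (I : finType) n w : w \in words I n -> size w = n.
Proof.
elim: n w => [|n IH] w; first by rewrite inE => /eqP->.
by case/allpairsP=> [[i v]] /= [_ /IH <- ->].
Qed.

Section Transvections.
Variable R : comNzRingType.

(* v |-> v + x (v_1 - a v_0) (1, a), the transvections along the line of (1, a). *)
Definition transvection (x a : R) : 'M[R]_2 :=
  mx2 (1 - x * a) x (- (x * a ^+ 2)) (1 + x * a).

Lemma det_transvection x a : \det (transvection x a) = 1.
Proof. by rewrite det_mx2; ring. Qed.

Lemma transvectionN x a : transvection x a *m transvection (- x) a = 1%:M.
Proof. by rewrite mulmx2; apply: mx2P; rewrite !mxE /=; ring. Qed.

Lemma transvection_row0 x a (M : 'M[R]_2) j :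
  (transvection x a *m M) 0 j = M 0 j + x * (M 1 j - a * M 0 j).
Proof. by rewrite mulmx2E !mxE /=; ring. Qed.

Lemma transvection_row1 x a (M : 'M[R]_2) j :
  (transvection x a *m M) 1 j = M 1 j + a * (x * (M 1 j - a * M 0 j)).
Proof. by rewrite mulmx2E !mxE /=; ring. Qed.

Definition letter_mx (x : R) (a : 'I_5 -> R) (l : letter) : 'M[R]_2 :=
  transvection (if l.2 then x else - x) (a l.1).

Definition word_mx (x : R) (a : 'I_5 -> R) (w : seq letter) : 'M[R]_2 :=
  foldr (fun l M => letter_mx x a l *m M) 1%:M w.

Lemma det_letter_mx x a l : \det (letter_mx x a l) = 1.
Proof. exact: det_transvection. Qed.

Lemma det_word_mx x a w : \det (word_mx x a w) = 1.
Proof. by elim: w => [|l w IH] /=; rewrite ?det1 // det_mulmx IH det_letter_mx mulr1. Qed.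

End Transvections.

(** * Degree growth over F[X] and the count of trivial words *)

Section GenericWords.
Variables (F : finFieldType) (a : 'I_5 -> F).
Hypothesis a_inj : injective a.
Implicit Types (u : {poly F} * {poly F}) (w : seq letter) (t : F).

Let aX i : {poly F} := (a i)%:P.

Definition letter_psl t (l : letter) : PSL2 F := psl (letter_mx t a l).

Lemma letter_psl_opp t l : letter_psl t (letter_opp l) = (letter_psl t l)^-1%g.
Proof.
apply: (mulgI (letter_psl t l)); rewrite mulgV -pslM ?det_letter_mx //.
rewrite /letter_mx /=; case: l.2 => /=.
  by rewrite transvectionN; apply/eqP; rewrite psl_eq1 ?det1 ?scalar_mx_is_scalar.
rewrite -{2}[t]opprK transvectionN.
by apply/eqP; rewrite psl_eq1 ?det1 ?scalar_mx_is_scalar.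
Qed.

Lemma word_psl t w : (\prod_(l <- w) letter_psl t l)%g = psl (word_mx t a w).
Proof.
elim: w => [|l w IH].
  by rewrite big_nil; apply/esym/eqP; rewrite psl_eq1 ?det1 ?scalar_mx_is_scalar.
by rewrite big_cons IH /= pslM ?det_letter_mx ?det_word_mx.
Qed.

Definition generic_word w : 'M[{poly F}]_2 := word_mx 'X aX w.

Lemma horner_generic_word t w i j : (generic_word w i j).[t] = word_mx t a w i j.
Proof.
elim: w i j => [|l w IH] i j /=; first by rewrite !mxE; case: (i == j); rewrite !hornerE.
rewrite /generic_word /= !mulmx2E !hornerE !IH /letter_mx.
by case: l => k [] /=; rewrite !mxE /=; case: ifP => _; rewrite !hornerE.
Qed.

Lemma size_letter_mx l i j : (size (letter_mx 'X aX l i j) <= 2)%N.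
Proof.
have sX k (b : bool) (c : F) :
    (size (((if b then 'X else - 'X) * (c%:P) ^+ k)%R : {poly F}) <= 2)%N.
  apply: leq_trans (size_polyMleq _ _) _; rewrite -rmorphXn /=.
  have := size_polyC_leq1 (c ^+ k).
  by case: b; rewrite ?size_polyN size_polyX; case: (size _) => [|[]].
have s1 : (size (1%R : {poly F}) <= 2)%N by rewrite size_poly1.
rewrite /letter_mx /transvection mxE -[aX l.1]expr1.
have h1 := sX 1%N l.2 (a l.1); have h2 := sX 2 l.2 (a l.1).
do 2!case: ifP => _.
- by apply: leq_trans (size_polyD _ _) _; rewrite geq_max s1 size_polyN.
- by have := sX 0%N l.2 0; rewrite expr0 mulr1.
- by rewrite size_polyN.
- by apply: leq_trans (size_polyD _ _) _; rewrite geq_max s1.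
Qed.

Lemma size_generic_word w i j : (size (generic_word w i j) <= (size w).+1)%N.
Proof.
elim: w i j => [|l w IH] i j; rewrite /generic_word /=.
  by rewrite !mxE; case: (i == j); rewrite ?size_poly1 ?size_poly0.
rewrite mulmx2E; apply: leq_trans (size_polyD _ _) _; rewrite geq_max.
have leM k : (size (letter_mx 'X aX l i k * generic_word w k j)%R <= (size w).+2)%N.
  apply: leq_trans (size_polyMleq _ _) _.
  by rewrite -subn1 leq_subLR (leq_trans (leq_add (size_letter_mx l i k) (IH k j))).
by rewrite !leM.
Qed.

Definition vec_size u : nat := maxn (size u.1) (size u.2).

(** The generic transvection of [l] applied to the column vector [u]; [word_vec] is thus the first
    column of the generic word. *)
Definition letter_step (l : letter) u : {poly F} * {poly F} :=
  let x := if l.2 then 'X else - 'X in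
  let d := x * (u.2 - (a l.1)%:P * u.1) in
  (u.1 + d, u.2 + (a l.1)%:P * d).

Definition word_vec w : {poly F} * {poly F} := foldr letter_step (1, 0) w.

Lemma word_vecE w : word_vec w = (generic_word w 0 0, generic_word w 1 0).
Proof.
elim: w => [|l w /= ->]; rewrite /generic_word /=; first by rewrite !mxE.
by rewrite /letter_mx !transvection_row0 !transvection_row1.
Qed.

Lemma letter_stepK l u : letter_step (letter_opp l) (letter_step l u) = u.
Proof.
by case: u l => u0 u1 [i []]; rewrite /letter_step /=; congr pair; ring.
Qed.

Lemma size_letter_shift (b : bool) (p : {poly F}) :
  p != 0 -> size ((if b then 'X else - 'X) * p) = (size p).+1.
Proof. by move=> p0; case: b; rewrite ?mulNr ?size_polyN mulrC size_mulX. Qed.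

Lemma size_direction i u : (size (u.2 - (a i)%:P * u.1)%R <= vec_size u)%N.
Proof.
apply: leq_trans (size_polyD _ _) _; rewrite geq_max leq_maxr size_polyN mul_polyC.
by rewrite (leq_trans (size_scale_leq _ _)) // leq_maxl.
Qed.

Lemma vec_size_step l u : (vec_size (letter_step l u) <= (vec_size u).+1)%N.
Proof.
have szd : (size ((if l.2 then 'X else - 'X) * (u.2 - (a l.1)%:P * u.1))%R
            <= (vec_size u).+1)%N.
  have [->|d0] := eqVneq (u.2 - (a l.1)%:P * u.1) 0; first by rewrite mulr0 size_poly0.
  by rewrite size_letter_shift // ltnS size_direction.
rewrite /letter_step {1}/vec_size /= geq_max; apply/andP; split.
  by rewrite (leq_trans (size_polyD _ _)) // geq_max szd leqW ?leq_maxl.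
rewrite (leq_trans (size_polyD _ _)) // geq_max leqW ?leq_maxr //= mul_polyC.
exact: leq_trans (size_scale_leq _ _) szd.
Qed.

(** The opposite letter undoes the step, and it too raises the size by at most one. *)
Lemma vec_size_step_ge l u : (vec_size u <= (vec_size (letter_step l u)).+1)%N.
Proof. by rewrite -{1}(letter_stepK l u) vec_size_step. Qed.

(** For nonzero [u]: its vector of top-degree coefficients lies on the line of (1, a_i), so the
    transvections along that line may fail to raise the degree. *)
Definition bad_direction u i : bool :=
  (size (u.2 - (a i)%:P * u.1)%R < vec_size u)%N.

(** Off the bad direction the added multiple of (1, a_i) has larger degree than [u], so the first
    coordinate alone grows. *)
Lemma vec_size_step_good l u :
  (0 < vec_size u)%N -> ~~ bad_direction u l.1 ->
  ((vec_size u).+1 <= vec_size (letter_step l u))%N.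
Proof.
rewrite /bad_direction -leqNgt => D0 good.
have d0 : u.2 - (a l.1)%:P * u.1 != 0 by rewrite -size_poly_gt0 (leq_trans D0).
have szd := size_letter_shift l.2 d0.
rewrite /letter_step [X in (_ <= X)%N]/vec_size /= leq_max addrC.
rewrite size_polyDl szd ?ltnS ?good //.
by apply: leq_trans good; rewrite leq_maxl.
Qed.

(* Two bad directions would make both coordinates of [u] of smaller degree. *)
Lemma bad_direction_unique u i j :
  (0 < vec_size u)%N -> bad_direction u i -> bad_direction u j -> i = j.
Proof.
rewrite /bad_direction => D0 bi bj; apply/eqP; apply: contraT => ij.
have c0 : a j - a i != 0 by rewrite subr_eq0 (inj_eq a_inj) eq_sym.
have u1 : (size u.1 < vec_size u)%N.
  rewrite -(size_scale _ c0) -mul_polyC.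
  have -> : (a j - a i)%:P * u.1 = (u.2 - (a i)%:P * u.1) - (u.2 - (a j)%:P * u.1).
    by rewrite polyCB; ring.
  by apply: leq_ltn_trans (size_polyD _ _) _; rewrite size_polyN gtn_max bi.
have u2 : (size u.2 < vec_size u)%N.
  rewrite -[u.2](subrK ((a i)%:P * u.1)).
  apply: leq_ltn_trans (size_polyD _ _) _; rewrite gtn_max bi mul_polyC.
  exact: leq_ltn_trans (size_scale_leq _ _) u1.
by rewrite -(ltnn (vec_size u)) {1}/vec_size gtn_max u1.
Qed.

Lemma word_vec_neq0 w : (0 < vec_size (word_vec w))%N.
Proof.
elim: w => [|l w IH] /=; first by rewrite leq_max size_poly1.
rewrite lt0n; apply: contraL IH => /eqP e.
have [e1 e2] : (letter_step l (word_vec w)).1 = 0 /\ (letter_step l (word_vec w)).2 = 0.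
  move: e; rewrite /vec_size; move: (letter_step _ _) => v e.
  by split; apply/eqP; rewrite -size_poly_eq0 -leqn0 -e ?leq_maxl ?leq_maxr.
rewrite -(letter_stepK l (word_vec w)); case: (letter_step _ _) e1 e2 => v1 v2 /= -> ->.
by rewrite /letter_step /vec_size /= !mulr0 subr0 !mulr0 !addr0 size_poly0.
Qed.

(* Of the ten letters at least eight halve the weight 2^-size, and the two of a
   bad direction at most double it: 8 / 2 + 2 * 2 = 8. *)
Lemma sum_step_weight u :
  (0 < vec_size u)%N ->
  \sum_(l : letter) 2^-1 ^+ vec_size (letter_step l u) <= 8 * 2^-1 ^+ vec_size u :> rat.
Proof.
move=> D0; pose z : rat := 2^-1; rewrite -/z.
have zmono m k : (m <= k)%N -> z ^+ k <= z ^+ m.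
  by move=> mk; rewrite ler_wiXn2l // /z; lra.
rewrite (eq_bigr (fun l => z ^+ vec_size (letter_step (l.1, l.2) u))); last by case.
rewrite -(pair_bigA _ (fun i b => z ^+ vec_size (letter_step (i, b) u))) /=.
(* The two letters of a line together weigh at most 1 if it is good and 4 if it is bad, relative to
   [u]. *)
apply: (@le_trans _ _ (\sum_i (z ^+ vec_size u * (1 + 3 * (bad_direction u i)%:R)))).
  apply: ler_sum => i _; rewrite big_bool /=.
  have le1 b : z ^+ vec_size (letter_step (i, b) u)
               <= z ^+ vec_size u * (1 + 3 * (bad_direction u i)%:R) / 2.
    case: (boolP (bad_direction u i)) => [_|good].
      have := vec_size_step_ge (i, b) u.
      rewrite -{1}(prednK D0) ltnS => /zmono /le_trans; apply.
      rewrite -[in X in _ <= X](prednK D0) exprS mulr1n.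
      by move: (z ^+ _) => y; rewrite /z; lra.
    have /zmono /le_trans := vec_size_step_good (l := (i, b)) D0 good; apply.
    by rewrite exprS mulr0n; move: (z ^+ _) => y; rewrite /z; lra.
  have := lerD (le1 true) (le1 false); lra.
rewrite -mulr_sumr mulrC ler_wpM2r ?exprn_ge0 //.
rewrite big_split /= sumr_const card_ord -mulr_sumr -natr_sum.
have : (\sum_i bad_direction u i <= 1)%N.
  rewrite -big_mkcond /= sum1_card; apply/card_le1_eqP => i j bi bj.
  exact: bad_direction_unique bj bi.
rewrite -(ler_nat rat); lra.
Qed.

Lemma sum_word_weight n :
  \sum_(w <- words letter n) 2^-1 ^+ vec_size (word_vec w) <= 8 ^+ n * 2^-1 :> rat.
Proof.
elim: n => [|n IH].
  by rewrite big_seq1 expr0 mul1r /vec_size /= size_poly1 size_poly0.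
rewrite big_words exchange_big /=.
apply: (@le_trans _ _ (\sum_(w <- words letter n) 8 * 2^-1 ^+ vec_size (word_vec w))).
  by apply: ler_sum => w _; apply: sum_step_weight; apply: word_vec_neq0.
by rewrite -mulr_sumr exprS -mulrA ler_wpM2l.
Qed.

(** A scalar word c has c^2 = 1, so c is a nonzero constant and the word keeps (1, 0) at size 1,
    with weight 1/2. The total weight is at most 8^n / 2. *)
Lemma generic_scalar_words n :
  (\sum_(w <- words letter n) is_scalar_mx (generic_word w) <= 8 ^ n)%N.
Proof.
rewrite -(ler_nat rat) natr_sum natrX.
rewrite -(@ler_pM2r _ 2^-1) //; apply: le_trans (sum_word_weight n); rewrite mulr_suml.
apply: ler_sum => w _; case: (boolP (is_scalar_mx _)) => [/is_scalar_mxP[c wc]|_]; last first.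
  by rewrite mul0r exprn_ge0.
rewrite mul1r word_vecE wc !mxE /= /vec_size /= size_poly0 maxn0.
have : c * c = 1 by rewrite -[RHS](det_word_mx 'X aX w) -/(generic_word w) wc det_scalar expr2.
move=> cc; have : c \is a GRing.unit by apply/unitrP; exists c.
by rewrite poly_unitE => /andP[/eqP-> _]; rewrite expr1.
Qed.

(** One of the off-diagonal entries or the difference of the diagonal ones is a nonzero polynomial
    of degree at most the length, and it vanishes at every such t. *)
Lemma specialized_scalar_words w :
  ~~ is_scalar_mx (generic_word w) ->
  (#|[set t | is_scalar_mx (word_mx t a w)]| <= size w)%N.
Proof.
move=> ns.
have roots (p : {poly F}) (Z : {set F}) : p != 0 -> (size p <= (size w).+1)%N ->
    (forall t, t \in Z -> p.[t] = 0) -> (#|Z| <= size w)%N.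
  move=> p0 szp hZ; rewrite -ltnS; apply: leq_trans szp; rewrite cardE.
  apply: max_poly_roots; rewrite ?enum_uniq //.
  by apply/allP => t; rewrite mem_enum => /hZ pt; apply/rootP.
have Zsc t : t \in [set t | is_scalar_mx (word_mx t a w)] ->
    [/\ word_mx t a w 0 1 = 0, word_mx t a w 1 0 = 0
      & word_mx t a w 0 0 = word_mx t a w 1 1].
  by rewrite inE => /is_scalar_mxP[c ->]; rewrite !mxE.
have [w01|w01] := eqVneq (generic_word w 0 1) 0; last first.
  apply: (roots _ _ w01); rewrite ?size_generic_word // => t /Zsc[].
  by rewrite horner_generic_word.
have [w10|w10] := eqVneq (generic_word w 1 0) 0; last first.
  apply: (roots _ _ w10); rewrite ?size_generic_word // => t /Zsc[].
  by rewrite horner_generic_word.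
have [w00|w00] := eqVneq (generic_word w 0 0 - generic_word w 1 1) 0; last first.
  apply: (roots _ _ w00) => [|t /Zsc[_ _ e]].
    by apply: leq_trans (size_polyD _ _) _; rewrite size_polyN geq_max !size_generic_word.
  by rewrite !hornerE !horner_generic_word e subrr.
case/negP: ns; apply/is_scalar_mxP; exists (generic_word w 0 0).
apply: mx2P; rewrite !mxE ?w01 ?w10 //=.
by apply/esym/eqP; rewrite -subr_eq0 w00.
Qed.

(** Double counting of pairs (t, w): a generically scalar word counts for every t, any other for at
    most n of them. A minimizing t does no worse than the mean. *)
Lemma few_trivial_words n :
  exists t, (#|F| * \sum_(w <- words letter n) ((\prod_(l <- w) letter_psl t l)%g == 1%g)
             <= #|F| * 8 ^ n + n * 10 ^ n)%N.
Proof.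
pose cnt t := (\sum_(w <- words letter n) ((\prod_(l <- w) letter_psl t l)%g == 1%g))%N.
have sum_le : (\sum_t cnt t <= #|F| * 8 ^ n + n * 10 ^ n)%N.
  rewrite exchange_big /=.
  apply: (@leq_trans (\sum_(w <- words letter n) (#|F| * is_scalar_mx (generic_word w) + n))).
    rewrite big_seq [X in (_ <= X)%N]big_seq; apply: leq_sum => w ww.
    have szw : size w = n by apply: size_mem_words.
    have -> : (\sum_t ((\prod_(l <- w) letter_psl t l)%g == 1%g)
               = #|[set t | is_scalar_mx (word_mx t a w)]|)%N.
      rewrite -sum1_card [RHS]big_mkcond; apply: eq_bigr => t _.
      by rewrite word_psl psl_eq1 ?det_word_mx // inE; case: is_scalar_mx.
    case: (boolP (is_scalar_mx (generic_word w))) => [_|/specialized_scalar_words].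
      by rewrite muln1 (leq_trans (max_card _)) ?leq_addr.
    by rewrite muln0 add0n szw.
  rewrite big_split /= -big_distrr leq_add //.
    by rewrite leq_mul2l generic_scalar_words orbT.
  by rewrite big_const_seq count_predT size_words iter_addn_0 card_prod card_ord card_bool.
have /card_gt0P[t0 _] : (0 < #|F|)%N by apply/card_gt0P; exists 0.
pose t := [arg min_(t < t0) cnt t].
exists t; apply: leq_trans sum_le; rewrite -sum_nat_const leq_sum // => t' _.
by rewrite /t; case: arg_minnP => // t1 _; apply.
Qed.

End GenericWords.

(** * Isoperimetry *)

Section CayleyGraph.
Variables (gT : finGroupType) (S : {set gT}).
Implicit Types (A : {set gT}) (x y s : gT).

Lemma cayley_sym : symmetric (cayley S).
Proof.
suff imp x y : cayley S x y -> cayley S y x by move=> x y; apply/idP/idP; apply: imp.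
case/exists_inP=> s; rewrite in_setU mem_invg => sS /eqP ->.
apply/exists_inP; exists s^-1%g; last by rewrite mulgK.
by rewrite in_setU mem_invg invgK orbC.
Qed.

Lemma cayley_regular : regular_graph (cayley S).
Proof.
exists #|S :|: S^-1%g| => x; rewrite -[RHS](card_imset _ (mulgI x)).
congr #|pred_of_set _|; apply/setP => y; rewrite inE /cayley.
apply/exists_inP/imsetP => [[s sS /eqP ->]|[s sS ->]]; exists s => //.
Qed.

Lemma mem_vertex_boundary A y :
  (y \in vertex_boundary (cayley S) A) = (y \notin A) && [exists x in A, cayley S x y].
Proof.
have walk0 x : has_walk (cayley S) 0 x y = (x == y).
  apply/existsP/idP => [[p]|xy]; first by rewrite tuple0.
  by exists [tuple]; rewrite /= xy.
have walk1 x : has_walk (cayley S) 1 x y = cayley S x y.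
  apply/existsP/idP => [[p]|xy]; last by exists [tuple y]; rewrite /= xy eqxx.
  by case: p => [[|z [|? ?]] //= _]; rewrite andbT => /andP[xz /eqP <-].
rewrite inE /set_distance andbC; congr (_ && _).
  apply/forallP/idP => [/(_ ord0)|yA m].
    apply: contra => yA; apply/exists_inP; exists y => //.
    by rewrite walk0.
  rewrite (ord1 m); apply: contra yA => /exists_inP[x xA].
  by rewrite walk0 => /eqP <-.
by apply: eq_existsb => x; rewrite walk1.
Qed.

Lemma rcosetD_sub_boundary A s :
  s \in S -> (A :* s)%g :\: A \subset vertex_boundary (cayley S) A.
Proof.
move=> sS; apply/subsetP => y; rewrite inE mem_vertex_boundary => /andP[-> /=].
rewrite mem_rcoset => yA; apply/exists_inP; exists (y * s^-1)%g => //.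
by apply/exists_inP; exists s; rewrite ?in_setU ?sS // mulgKV.
Qed.

Section Isoperimetry.
Variable D : nat.
Hypothesis isoperimetry : forall A, (#|A|.*2 <= #|gT|)%N ->
  (#|A| <= D * #|vertex_boundary (cayley S) A|)%N.

(** The subgroup generated by [S] has empty boundary, while a proper subgroup fills at most half of
    the group. *)
Lemma isoperimetry_generates : <<S>>%g = [set: gT].
Proof.
apply/eqP; rewrite eqEcard subsetT cardsT leqNgt; apply/negP => ltS.
have le2 : (#|<<S>>%g|.*2 <= #|gT|)%N.
  have /dvdnP[k kE] := cardSg (subsetT <<S>>%G); rewrite cardsT in kE.
  rewrite -muln2 mulnC kE leq_mul2r; case: k kE => [|[|k]] kE; rewrite ?orbT //.
    by move: ltS; rewrite kE.
  by move: ltS; rewrite kE mul1n (ltnn #|<<S>>%g|).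
have := isoperimetry le2; rewrite (_ : vertex_boundary _ _ = set0).
  by rewrite cards0 muln0 leqNgt cardG_gt0.
apply/setP => y; rewrite mem_vertex_boundary in_set0; apply/negP => /andP[/negP ny].
case/exists_inP=> x xS /exists_inP[s sS /eqP yE]; case: ny; rewrite yE groupM //.
by move: sS; rewrite in_setU mem_invg => /orP[|sS]; [|rewrite -groupV]; apply: mem_gen.
Qed.

Lemma isoperimetry_expander (R : realType) :
  (0 < D)%N -> expander (cayley S) (D%:R^-1 : R).
Proof.
move=> D0; split; [exact: cayley_sym | exact: cayley_regular | |].
  by rewrite invr_gt0 ltr0n.
move=> A; rewrite ler_pdivlMl ?ltr0n // -natrM ler_nat mul2n => /isoperimetry.
by rewrite ler_pdivrMl ?ltr0n // -natrM ler_nat.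
Qed.

End Isoperimetry.
End CayleyGraph.

(** With all elements as generators, the boundary of a nonempty set is its whole complement. *)
Lemma full_isoperimetry (gT : finGroupType) (A : {set gT}) (D : nat) :
  (0 < D)%N -> (#|A|.*2 <= #|gT|)%N ->
  (#|A| <= D * #|vertex_boundary (cayley [set: gT]) A|)%N.
Proof.
move=> D0 leA; have [-> | [x xA]] := set_0Vmem A; first by rewrite cards0.
apply: leq_trans (leq_pmull _ D0).
have sub : ~: A \subset vertex_boundary (cayley [set: gT]) A.
  apply/subsetP => y; rewrite inE mem_vertex_boundary => -> /=.
  apply/exists_inP; exists x => //; apply/exists_inP; exists (x^-1 * y)%g.
    by rewrite in_setU in_setT.
  by rewrite mulKVg.
apply: leq_trans (subset_leq_card sub).
by rewrite -(leq_add2l #|A|) addnn cardsC.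
Qed.

(** * Isoperimetry in PSL2 and the choice of constants *)

Lemma card_psl (F : finFieldType) : (#|PSL2 F| <= #|F| ^ 4)%N.
Proof.
have <- : #|{: 'M[F]_2}| = (#|F| ^ 4)%N by rewrite card_mx.
rewrite -[#|PSL2 F|]cardsT; apply: leq_trans (leq_imset_card (@psl F) _).
apply/subset_leq_card/subsetP => x _; have [A _ <-] := psl_surj x.
exact: imset_f.
Qed.

Lemma five_elements (F : finFieldType) :
  (5 <= #|F|)%N -> exists a : 'I_5 -> F, injective a.
Proof.
move=> le5; exists (fun i => enum_val (widen_ord le5 i)) => i j /enum_val_inj/(congr1 val) ij.
exact: val_inj.
Qed.

(* With words of length 8 r: eta + kappa <= 10 / 4^r and theta^-(8 r) <= 2^r give
   projections of normalized trace at most 2^(4 - r), and 17 of them beat the group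
   order, which is below 2^(16 r + 16). *)
Lemma large_field_isoperimetry (F : finFieldType) (r : nat) :
    (86 <= r)%N -> (16 ^ r <= #|F|)%N -> (#|F| < 16 ^ r.+1)%N ->
  exists2 S : {set PSL2 F}, (#|S| <= 17 * 10)%N &
    forall A : {set PSL2 F}, (#|A|.*2 <= #|PSL2 F|)%N ->
      (#|A| <= 16 * 2 ^ 21 * #|vertex_boundary (cayley S) A|)%N.
Proof.
move=> r86 leF ltF.
have r0 : (0 < r)%N by apply: leq_trans r86.
have [a a_inj] : exists a : 'I_5 -> F, injective a.
  apply: five_elements; apply: leq_trans leF; apply: (@leq_trans (16 ^ 1)) => //.
  by rewrite leq_exp2l.
have [t few] := few_trivial_words a_inj (8 * r).
(* The criterion speaks of words of length n + 1; [n] is odd, so the spectral cut gets an even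
   power. *)
pose n := (8 * r).-1; have nE : n.+1 = (8 * r)%N by rewrite prednK // muln_gt0.
have F0 : (0 < #|F|)%N by apply/card_gt0P; exists 0.
pose eta : algC := 2 / 4 ^+ r; pose kappa : algC := 8 / 4 ^+ r.
have r4 : 0 < 4 ^+ r :> algC by rewrite exprn_gt0.
have card_letter : #|letter| = 10%N by rewrite card_prod card_ord card_bool.
have kappa0 : 0 <= kappa by rewrite divr_ge0 ?ler0n // ltW.
have few_eta : (\sum_(w <- words letter n.+1)
    (\prod_(l <- w) letter_psl a t l == 1)%g)%N%:R <= eta * #|letter|%:R ^+ n.+1.
  rewrite nE /eta mulrAC ler_pdivlMr // card_letter -!natrX -!natrM ler_nat.
  move: few; set cnt := (\sum_(w <- _) _)%N => few.
  (* The two terms of [few] each contribute a proportion of at most 4^-r: (8/10)^(8r) because 2 *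
     8^4 <= 10^4, and 8r/q because 8r <= 4^r and 16^r <= q. *)
  have exp_le : (4 ^ r * 8 ^ (8 * r) <= 10 ^ (8 * r))%N.
    have base : (2 * 8 ^ 4 <= 10 ^ 4)%N by vm_compute.
    have e2 x : (x ^ (8 * r) = (x ^ 4) ^ (2 * r))%N by rewrite -expnM mulnA.
    rewrite !e2 (_ : 4 ^ r = 2 ^ (2 * r))%N; last by rewrite expnM.
    move: (8 ^ 4)%N (10 ^ 4)%N base => x y base.
    by rewrite -expnMn leq_exp2r // muln_gt0.
  have lin_le : (8 * r * 4 ^ r <= #|F|)%N.
    apply: leq_trans leF; rewrite (expnMn 4 4) leq_mul2r; apply/orP; right.
    rewrite (expnMn 2 2) leq_mul ?(ltnW (ltn_expl _ _)) //.
    by rewrite (leq_pexp2l (_ : 0 < 2) (_ : 3 <= r))%N // (leq_trans _ r86).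
  rewrite -(leq_pmul2l F0) mulnA; apply: leq_trans (leq_mul few (leqnn (4 ^ r))) _.
  rewrite mulnDl mul2n -addnn mulnDr leq_add //.
    by rewrite -mulnA leq_mul2l (mulnC (8 ^ _)%N) exp_le orbT.
  by rewrite mulnAC leq_mul2r lin_le orbT.
have chi (i : Iirr [set: PSL2 F]) g : i != 0 -> g != 1%g -> `|'chi_i g| <= kappa * 'chi_i 1%g.
  exact: psl_character_ratio.
pose theta : algC := 15 / 16.
have theta01 : 0 < theta < 1.
  by rewrite divr_gt0 ?ltr0n //= ltr_pdivrMr ?ltr0n // mul1r ltr_nat.
have small : ((eta + kappa) / theta ^+ n.+1) ^+ 17 * #|PSL2 F|%:R <= 4^-1.
  (* By repeated squaring: (16/15)^2 <= 8/7, (8/7)^2 <= 4/3 and (4/3)^2 <= 2. *)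
  have thetaV8 : theta^-1 ^+ 8 <= 2.
    have sq (x y z : algC) : 0 <= x -> x <= y -> y ^+ 2 <= z -> x ^+ 2 <= z.
      by move=> x0 xy; apply: le_trans; rewrite ler_pXn2r ?nnegrE ?(le_trans x0).
    have x0 : 0 <= theta^-1 by rewrite invr_ge0 ltW; case/andP: theta01.
    rewrite (exprM _ 4 2) (exprM _ 2 2); apply: (sq _ (4 / 3)); first by rewrite !exprn_ge0.
      apply: (sq _ (8 / 7)); first by rewrite exprn_ge0.
        rewrite /theta invf_div expr_div_n ler_pdivrMr ?exprn_gt0 // mulrAC ler_pdivlMr //.
        by rewrite -!natrX -!natrM ler_nat.
      rewrite expr_div_n ler_pdivrMr ?exprn_gt0 // mulrAC ler_pdivlMr //.
      by rewrite -!natrX -!natrM ler_nat.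
    by rewrite expr_div_n ler_pdivrMr ?exprn_gt0 // -!natrX -!natrM ler_nat.
  have r2 : 0 < 2 ^+ r :> algC by rewrite exprn_gt0.
  have step : (eta + kappa) / theta ^+ n.+1 <= 2 ^+ 4 / 2 ^+ r.
    have -> : (theta ^+ n.+1)^-1 = (theta^-1 ^+ 8) ^+ r by rewrite nE -exprVn exprM.
    have t0 : 0 <= theta^-1 ^+ 8 by rewrite exprn_ge0 // invr_ge0 ltW; case/andP: theta01.
    rewrite -mulrDl -natrD; apply: (@le_trans _ _ (16 / 4 ^+ r * 2 ^+ r)).
      apply: ler_pM; first by rewrite divr_ge0 ?ler0n ?(ltW r4).
      - exact: exprn_ge0.
      - by rewrite ler_wpM2r ?invr_ge0 ?(ltW r4) // ler_nat.
      - by rewrite ler_pXn2r ?nnegrE.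
    rewrite (_ : 4 ^+ r = 2 ^+ r * 2 ^+ r :> algC); last by rewrite -exprMn -natrM.
    have -> : 16 = 2 ^+ 4 :> algC by rewrite -natrX.
    by rewrite invfM mulrA divfK // gt_eqF.
  have c0 : 0 <= (eta + kappa) / theta ^+ n.+1.
    by rewrite divr_ge0 ?addr_ge0 ?exprn_ge0 ?divr_ge0 ?ler0n ?(ltW r4).
  have cardP : #|PSL2 F|%:R <= 2 ^+ (16 * r.+1) :> algC.
    rewrite -natrX ler_nat; apply: leq_trans (card_psl F) _.
    rewrite (_ : 16 * r.+1 = 4 * r.+1 * 4)%N; last by rewrite mulnAC.
    by rewrite expnM leq_exp2r // expnM ltnW.
  (* The exponent of 2 is 17 (4 - r) + 16 r + 16 = 84 - r, which is at most -2 exactly when r >=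
     86. *)
  apply: (@le_trans _ _ ((2 ^+ 4 / 2 ^+ r) ^+ 17 * 2 ^+ (16 * r.+1))).
    rewrite ler_pM ?exprn_ge0 ?ler0n // ler_pXn2r // nnegrE //.
    by rewrite divr_ge0 ?exprn_ge0 ?ler0n.
  rewrite expr_div_n mulrAC ler_pdivrMr ?exprn_gt0 // -!exprM -exprD.
  rewrite mulrC ler_pdivlMr ?ltr0n //.
  rewrite [X in _ * X <= _](_ : _ = 2 ^+ 2); last by rewrite -natrX.
  rewrite -exprD ler_eXn2l ?ltr1n //.
  by clear -r86; lia.
have oddn : odd n by rewrite -[odd n]negbK -oddS nE oddM.
have letter0 : (0 < #|letter|)%N by rewrite card_letter.
have [xs sxs iso] := conjugates_expand letter_oppK (letter_psl_opp a t) letter0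
  kappa0 chi few_eta theta01 oddn small.
pose f (p : PSL2 F * letter) := (p.1 * letter_psl a t p.2 * p.1^-1)%g.
exists (f @: setX [set x in xs] [set: letter]).
  apply: leq_trans (leq_imset_card _ _) _.
  by rewrite cardsX cardsT card_letter leq_mul2r /= cardsE -sxs card_size.
move=> A leA; set b := #|vertex_boundary _ _|.
have hb x l : x \in xs ->
    (#|(A :* (x * letter_psl a t l * x^-1))%g :\: A| <= b)%N.
  move=> xxs; apply/subset_leq_card/rcosetD_sub_boundary.
  by apply/imsetP; exists (x, l); rewrite // in_setX !inE /= xxs.
have := iso A b leA hb.
rewrite (_ : 1 - theta = 16^-1); last by rewrite /theta; field.
by rewrite ler_pdivrMl ?ltr0n // -natrX -!natrM ler_nat mulnA.
Qed.

Lemma uniform_isoperimetry : exists k D : nat, (0 < D)%N /\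
  forall F : finFieldType, exists2 S : {set PSL2 F}, (#|S| <= k)%N &
    forall A : {set PSL2 F}, (#|A|.*2 <= #|PSL2 F|)%N ->
      (#|A| <= D * #|vertex_boundary (cayley S) A|)%N.
Proof.
(* Naming the constants keeps the unary numerals from being evaluated. *)
have [q0 q0E] : exists q0, q0 = (16 ^ 86)%N by exact: (ex_intro _ _ erefl).
have [e eE] : exists e, e = 21%N by exists 21%N.
pose D := (16 * 2 ^ e)%N; have D0 : (0 < D)%N by rewrite muln_gt0 expn_gt0.
(* Below [q0] the whole group, of order at most q^4, serves as generating set. *)
exists (maxn (17 * 10) (q0 ^ 4)), D; split=> // F.
have [le_q0|lt_q0] := leqP q0 #|F|.
  have F0 : (0 < #|F|)%N by apply/card_gt0P; exists 0.
  have /andP[le_r lt_r] := @trunc_log_bounds 16 #|F| isT F0.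
  have r86 : (86 <= trunc_log 16 #|F|)%N by apply: trunc_log_max; rewrite -?q0E.
  have [S cardS iso] := large_field_isoperimetry r86 le_r lt_r.
  by exists S; rewrite /D ?eE // leq_max cardS.
exists [set: PSL2 F] => [|A]; last exact: full_isoperimetry.
rewrite leq_max cardsT; apply/orP; right; apply: leq_trans (card_psl F) _.
by rewrite leq_exp2r // ltnW.
Qed.

Theorem theorem1p3 (R : realType) :
  exists (k : nat) (eps : R), 0 < eps /\
    forall (q : nat), prime_power q ->
    forall (F : finFieldType), #|F| = q ->
    exists S : {set PSL2 F},
      [/\ (#|S| <= k)%N, <<S>>%g = [set: PSL2 F] & expander (cayley S) eps].
Proof.
have [k [D [D0 iso]]] := uniform_isoperimetry.
exists k, D%:R^-1; split; first by rewrite invr_gt0 ltr0n.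
move=> q _ F _; have [S cardS isoS] := iso F.
exists S; split=> //; first exact: isoperimetry_generates isoS.
exact: isoperimetry_expander.
Qed.
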